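(* Let $R$ be a Noetherian commutative ring with non-zero identity and $I$ an ideal of $R$. Let $M$ be a finitely generated $R$-module, $N$ an $R$-module and $t$ a non-negative integer. If $\mathrm{Supp}_R(R^iD_I(N))$ is a finite set for all $i\leq t$, then $\mathrm{Supp}_R(R^tD_I(M,N))$ is also a finite set.
   Context: For $R$-modules $M,N$, the generalized ideal transform is $D_I(M,N)=\varinjlim_n \mathrm{Hom}_R(I^nM,N)$, the transition maps being restriction along $I^{j}M\subseteq I^{i}M$ for $i\le j$; $R^iD_I(M,-)$ denotes the $i$-th right derived functor of $D_I(M,-)$ (so $R^0D_I(M,-)=D_I(M,-)$), and it is isomorphic to $\varinjlim_n \mathrm{Ext}^i_R(I^nM,-)$. The ordinary ideal transform is $D_I(N)=\varinjlim_n\mathrm{Hom}_R(I^n,N)=D_I(R,N)$ and $R^iD_I(N)$ is the value at $N$ of its $i$-th right derived functor. *)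

(* Defs.v *)
From HB Require Import structures.
From mathcomp Require Import all_boot all_order all_algebra.
From mathcomp Require Import boolp classical_sets functions cardinality.
From mathcomp Require Import ring.

Set Implicit Arguments.
Unset Strict Implicit.
Unset Printing Implicit Defensive.

Import GRing.Theory.
Local Open Scope ring_scope.
Local Open Scope quotient_scope.

Section LinearOf.
Variables (R : pzRingType) (A B : lmodType R) (f : A -> B) (linf : linear f).

Definition lin_fun (_ : linear f) : A -> B := f.

HB.instance Definition _ :=
  GRing.isLinear.Build R A B _ (lin_fun linf) linf.

Definition mk_linear : {linear A -> B} := lin_fun linf.

End LinearOf.

Lemma linear_eq (R : pzRingType) (A B : lmodType R) (f g : {linear A -> B}) :
  f =1 g -> f = g.
Proof.
case: f g => f cf [g cg] /= /funext fg; subst g; congr GRing.Linear.Pack.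
case: cf cg => [[F1] [F2]] [[G1] [G2]].
by rewrite (Prop_irrelevance F1 G1) (Prop_irrelevance F2 G2).
Qed.

Section Submodule.
Variables (R : pzRingType) (V : lmodType R).

Record submod (S : submodClosed V) :=
  Submod { submod_val :> V; submod_valP : submod_val \in S }.

Section Structure.
Variable S : submodClosed V.

HB.instance Definition _ := [isSub for @submod_val S].
HB.instance Definition _ := [Choice of submod S by <:].
HB.instance Definition _ := [SubChoice_isSubLmodule of submod S by <:].

Lemma submod_val_linear : linear (@submod_val S).
Proof. exact: (linearP (val : submod S -> V)). Qed.

Definition submod_inj : {linear submod S -> V} := mk_linear submod_val_linear.

End Structure.

Section Inclusion.
Variables (S T : submodClosed V) (ST : {subset S <= T}).

Definition submod_incl_fun (x : submod S) : submod T :=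
  Submod (ST (submod_valP x)).

Lemma submod_incl_linear : linear submod_incl_fun.
Proof. by move=> a x y; apply: val_inj. Qed.

Definition submod_incl : {linear submod S -> submod T} :=
  mk_linear submod_incl_linear.

End Inclusion.
End Submodule.

Section QuotientModule.
Variables (R : pzRingType) (V : lmodType R) (S : submodClosed V).

Definition submod_zpred : V -> bool := fun x => x \in S.

HB.instance Definition _ := GRing.isZmodClosed.Build V submod_zpred
  (GRing.submod_closedB (GRing.submodClosedP S)).

Definition submod_zmod : zmodClosed V :=
  GRing.ZmodClosed.clone V submod_zpred _.

Definition quomod : Type := Quotient.quot submod_zmod.
HB.instance Definition _ := GRing.Zmodule.on quomod.

Definition to_quomod (x : V) : quomod := \pi_(Quotient.quot submod_zmod) x.

Lemma to_quomodP x y : to_quomod x = to_quomod y <-> x - y \in S.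
Proof.
split=> [|xy]; first by move/eqP; rewrite /to_quomod -Quotient.idealrBE.
by apply/eqP; rewrite /to_quomod -Quotient.idealrBE.
Qed.

Lemma to_quomodD x y : to_quomod (x + y) = to_quomod x + to_quomod y.
Proof. exact: (raddfD \pi_(Quotient.quot submod_zmod)). Qed.

Lemma to_quomod_surj u : exists x, u = to_quomod x.
Proof. by exists (repr (u : Quotient.quot submod_zmod)); rewrite /to_quomod reprK. Qed.

Definition quomod_scale (a : R) (u : quomod) : quomod :=
  to_quomod (a *: repr (u : Quotient.quot submod_zmod)).

Lemma to_quomodZ a x : to_quomod (a *: x) = quomod_scale a (to_quomod x).
Proof.
apply/to_quomodP; rewrite -scalerBr rpredZ //.
by apply/to_quomodP; rewrite /to_quomod reprK.
Qed.

Lemma quomod_scaleA a b u :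
  quomod_scale a (quomod_scale b u) = quomod_scale (a * b) u.
Proof. by have [x ->] := to_quomod_surj u; rewrite -!to_quomodZ scalerA. Qed.

Lemma quomod_scale1 : left_id 1 quomod_scale.
Proof. by move=> u; have [x ->] := to_quomod_surj u; rewrite -to_quomodZ scale1r. Qed.

Lemma quomod_scaleDr : right_distributive quomod_scale +%R.
Proof.
move=> a u v; have [x ->] := to_quomod_surj u; have [y ->] := to_quomod_surj v.
by rewrite -to_quomodD -!to_quomodZ scalerDr to_quomodD.
Qed.

Lemma quomod_scaleDl u : {morph quomod_scale^~ u : a b / a + b}.
Proof.
move=> a b; have [x ->] := to_quomod_surj u.
by rewrite -!to_quomodZ scalerDl to_quomodD.
Qed.

HB.instance Definition _ := GRing.Zmodule_isLmodule.Build R quomod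
  quomod_scaleA quomod_scale1 quomod_scaleDr quomod_scaleDl.

Lemma to_quomod_linear : linear to_quomod.
Proof. by move=> a x y; rewrite to_quomodD to_quomodZ. Qed.

Definition quomod_proj : {linear V -> quomod} := mk_linear to_quomod_linear.

End QuotientModule.

Section KernelImage.
Variables (R : pzRingType) (A B : lmodType R) (f : {linear A -> B}).

Definition ker_pred : A -> bool := fun x => f x == 0.
Definition im_pred : B -> bool := fun y => `[< exists x, y = f x >].

Lemma ker_closed : submod_closed ker_pred.
Proof.
split=> [|a x y]; rewrite !unfold_in /ker_pred ?linear0 // => /eqP fx /eqP fy.
by rewrite linearP fx fy scaler0 addr0.
Qed.

Lemma im_closed : submod_closed im_pred.
Proof.
split=> [|a x y]; rewrite !unfold_in.
  by apply/asboolP; exists 0; rewrite linear0.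
move=> /asboolP[u ->] /asboolP[v ->]; apply/asboolP.
by exists (a *: u + v); rewrite linearP.
Qed.

HB.instance Definition _ := GRing.isSubmodClosed.Build R A ker_pred ker_closed.
HB.instance Definition _ := GRing.isSubmodClosed.Build R B im_pred im_closed.

Definition ker_submod : submodClosed A :=
  GRing.SubmodClosed.clone R A ker_pred _.
Definition im_submod : submodClosed B :=
  GRing.SubmodClosed.clone R B im_pred _.

End KernelImage.

Section TrivialSubmodules.
Variables (R : pzRingType) (V : lmodType R).

Definition submod0_pred : V -> bool := fun x => x == 0.
Definition submodT_pred : V -> bool := fun=> true.

Lemma submod0_closed : submod_closed submod0_pred.
Proof.
split=> [|a x y]; rewrite !unfold_in /submod0_pred //.
by move=> /eqP-> /eqP->; rewrite scaler0 addr0.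
Qed.

Lemma submodT_closed : submod_closed submodT_pred.
Proof. by []. Qed.

HB.instance Definition _ :=
  GRing.isSubmodClosed.Build R V submod0_pred submod0_closed.
HB.instance Definition _ :=
  GRing.isSubmodClosed.Build R V submodT_pred submodT_closed.

Definition submod0 : submodClosed V :=
  GRing.SubmodClosed.clone R V submod0_pred _.
Definition submodT : submodClosed V :=
  GRing.SubmodClosed.clone R V submodT_pred _.

End TrivialSubmodules.
Arguments submod0 {R} V.
Arguments submodT {R} V.

(* An ideal of R, possibly improper, is a submodule of the regular module R^o. *)
Notation ideal R := (submodClosed R^o).

Section IdealProduct.
Variables (R : comNzRingType) (V : lmodType R).

Definition ideal_smul_pred (J : ideal R) (S : submodClosed V) : V -> bool :=
  fun x => `[< exists (n : nat) (a : 'I_n -> R) (s : 'I_n -> V),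
    [/\ forall i, a i \in J, forall i, s i \in S
      & x = \sum_(i < n) a i *: s i] >].

Lemma ideal_smul_closed J S : submod_closed (ideal_smul_pred J S).
Proof.
split=> [|c x y]; rewrite !unfold_in.
  apply/asboolP; exists 0%N, (fun=> 0), (fun=> 0).
  split=> [i|i|] /=; [exact: rpred0|exact: rpred0|by rewrite big_ord0].
move=> /asboolP[n [a [s [aJ sS ->]]]] /asboolP[m [b [t [bJ tS ->]]]].
apply/asboolP; exists (n + m)%N.
exists (fun k => match fintype.split k with inl i => a i | inr j => b j end).
exists (fun k => match fintype.split k with inl i => c *: s i | inr j => t j end).
have hl i : fintype.split (lshift m i) = inl i by exact: (unsplitK (inl i)).
have hr i : fintype.split (rshift n i) = inr i by exact: (unsplitK (inr i)).
split=> [k|k|].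
- by case: (fintype.split k).
- by case: (fintype.split k) => i //; exact: rpredZ.
- rewrite big_split_ord /= scaler_sumr; congr (_ + _); apply: eq_bigr => i _.
    by rewrite hl !scalerA mulrC.
  by rewrite hr.
Qed.

HB.instance Definition _ J S := GRing.isSubmodClosed.Build R V
  (ideal_smul_pred J S) (ideal_smul_closed J S).

Definition ideal_smul (J : ideal R) (S : submodClosed V) : submodClosed V :=
  GRing.SubmodClosed.clone R V (ideal_smul_pred J S) _.

Lemma ideal_smul_mono (J J' : ideal R) (S S' : submodClosed V) :
  {subset J <= J'} -> {subset S <= S'} ->
  {subset ideal_smul J S <= ideal_smul J' S'}.
Proof.
move=> JJ' SS' x; rewrite !unfold_in => /asboolP[n [a [s [aJ sS ->]]]].
by apply/asboolP; exists n, a, s; split=> // i; [exact: JJ'|exact: SS'].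
Qed.

Lemma ideal_smul_sub (J : ideal R) (S : submodClosed V) :
  {subset ideal_smul J S <= S}.
Proof.
move=> x; rewrite unfold_in => /asboolP[n [a [s [aJ sS ->]]]].
by rewrite rpred_sum // => i _; rewrite rpredZ.
Qed.

End IdealProduct.

Section IdealPower.
Variables (R : comNzRingType) (I : ideal R).

Fixpoint ideal_exp (n : nat) : ideal R :=
  if n is n'.+1 then ideal_smul I (ideal_exp n') else submodT R^o.

Lemma ideal_exp_anti i j : (i <= j)%N -> {subset ideal_exp j <= ideal_exp i}.
Proof.
move=> /subnK <-; elim: (j - i)%N => // k IH x.
by rewrite addSn => /ideal_smul_sub/IH.
Qed.

(* The submodule I^n M of M. *)
Definition exp_submod (M : lmodType R) (n : nat) : submodClosed M :=
  ideal_smul (ideal_exp n) (submodT M).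

Lemma exp_submod_anti (M : lmodType R) i j :
  (i <= j)%N -> {subset exp_submod M j <= exp_submod M i}.
Proof. by move=> ij; apply: ideal_smul_mono => //; exact: ideal_exp_anti. Qed.

End IdealPower.

Section HomModule.
Variables (R : comNzRingType) (A B : lmodType R).

Definition linear_pred : (A -> B) -> bool := fun f => `[< linear f >].

Lemma linear_pred_closed : submod_closed linear_pred.
Proof.
split=> [|c f g]; rewrite !unfold_in.
  by apply/asboolP => a x y; rewrite /= scaler0 addr0.
move=> /asboolP lf /asboolP lg; apply/asboolP => a x y.
rewrite -[LHS]/(c *: f (a *: x + y) + g (a *: x + y)).
rewrite -[RHS]/(a *: (c *: f x + g x) + (c *: f y + g y)).
by rewrite lf lg !scalerDr !scalerA (mulrC c) addrACA.
Qed.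

HB.instance Definition _ :=
  GRing.isSubmodClosed.Build R (A -> B) linear_pred linear_pred_closed.

Definition linear_submod : submodClosed (A -> B) :=
  GRing.SubmodClosed.clone R (A -> B) linear_pred _.

Definition hom : lmodType R := submod linear_submod.

Definition hom_fun (h : hom) : A -> B := submod_val h.

Lemma hom_linear (h : hom) : linear (hom_fun h).
Proof. by apply/asboolP; exact: (submod_valP h). Qed.

Definition hom_lin (h : hom) : {linear A -> B} := mk_linear (hom_linear h).

Definition lin_hom (f : {linear A -> B}) : hom :=
  @Submod R (A -> B) linear_submod f (asboolT (@linearP _ _ _ _ f)).

Lemma hom_eq (h k : hom) : hom_fun h =1 hom_fun k -> h = k.
Proof. by move=> hk; apply: val_inj; apply: funext. Qed.

End HomModule.

Section HomFunctoriality.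
Variables (R : comNzRingType).

Section Post.
Variables (A B C : lmodType R) (g : {linear B -> C}).

Definition hom_post_fun (h : hom A B) : hom A C :=
  lin_hom (g \o hom_lin h : {linear A -> C}).

Lemma hom_post_linear : linear hom_post_fun.
Proof. by move=> a h k; apply: hom_eq => x /=; exact: linearP. Qed.

Definition hom_post : {linear hom A B -> hom A C} := mk_linear hom_post_linear.
End Post.

Section Pre.
Variables (A B C : lmodType R) (f : {linear A -> B}).

Definition hom_pre_fun (h : hom B C) : hom A C :=
  lin_hom (hom_lin h \o f : {linear A -> C}).

Lemma hom_pre_linear : linear hom_pre_fun.
Proof. by move=> a h k; apply: hom_eq. Qed.

Definition hom_pre : {linear hom B C -> hom A C} := mk_linear hom_pre_linear.
End Pre.

End HomFunctoriality.


Record dirsys (R : pzRingType) := DirSys {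
  ds_obj :> nat -> lmodType R;
  ds_map : forall i j, (i <= j)%N -> {linear ds_obj i -> ds_obj j};
  ds_map_id : forall i (ii : (i <= i)%N) x, ds_map ii x = x;
  ds_map_comp : forall i j k (ij : (i <= j)%N) (jk : (j <= k)%N)
    (ik : (i <= k)%N) x, ds_map jk (ds_map ij x) = ds_map ik x }.

Section DirectLimit.
Variables (R : pzRingType) (X : dirsys R).

Definition dl_pre : Type := {n : nat & X n}.
HB.instance Definition _ := gen_eqMixin dl_pre.
HB.instance Definition _ := gen_choiceMixin dl_pre.

Definition dl_mk n (x : X n) : dl_pre := existT (fun n => X n) n x.

Definition dl_eq (u v : dl_pre) : bool :=
  `[< exists k (uk : (projT1 u <= k)%N) (vk : (projT1 v <= k)%N),
        ds_map X uk (projT2 u) = ds_map X vk (projT2 v) >].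

Lemma dl_eq_equiv : equiv_class_of dl_eq.
Proof.
split=> [[n x]|[n x] [m y]|[m y] [n x] [p z]].
- by apply/asboolP; exists n, (leqnn n), (leqnn n).
- by apply/asboolP/asboolP => -[k [nk [mk e]]]; exists k, mk, nk.
- move=> /asboolP[k [/= nk [mk e1]]] /asboolP[l [/= ml [pl e2]]].
  have kq := leq_maxl k l; have lq := leq_maxr k l.
  apply/asboolP; exists (maxn k l), (leq_trans nk kq), (leq_trans pl lq) => /=.
  rewrite -(ds_map_comp nk kq) e1 -(ds_map_comp pl lq) -e2.
  rewrite (ds_map_comp mk kq (leq_trans mk kq)).
  by rewrite (ds_map_comp ml lq (leq_trans mk kq)).
Qed.

Canonical dl_equivrel := EquivRelPack dl_eq_equiv.

Definition dirlim : Type := {eq_quot dl_eq}.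
HB.instance Definition _ := Choice.on dirlim.

Definition dl_in n (x : X n) : dirlim := \pi_({eq_quot dl_eq}) (dl_mk x).

Lemma dl_inP n m (x : X n) (y : X m) : dl_in x = dl_in y <->
  exists k (nk : (n <= k)%N) (mk : (m <= k)%N), ds_map X nk x = ds_map X mk y.
Proof.
split=> [/eqmodP/asboolP //|h].
by apply/eqmodP/asboolP.
Qed.

Lemma dl_in_map n m (nm : (n <= m)%N) (x : X n) : dl_in (ds_map X nm x) = dl_in x.
Proof. by apply/dl_inP; exists m, (leqnn m), nm; rewrite ds_map_id. Qed.

Lemma dl_in_surj u : exists n (x : X n), u = dl_in x.
Proof.
have := reprK (u : {eq_quot dl_eq}).
by case: (repr _) => n x <-; exists n, x.
Qed.

Definition dl_rep_deg (u : dirlim) : nat := projT1 (repr (u : {eq_quot dl_eq})).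
Definition dl_rep (u : dirlim) : X (dl_rep_deg u) :=
  projT2 (repr (u : {eq_quot dl_eq})).

Lemma dl_repK u : dl_in (dl_rep u) = u.
Proof.
rewrite -[RHS](reprK (u : {eq_quot dl_eq})) /dl_in /dl_mk /dl_rep /dl_rep_deg.
by case: (repr _).
Qed.

Lemma dl_in2_surj u v : exists n (x y : X n), u = dl_in x /\ v = dl_in y.
Proof.
have [n [x ->]] := dl_in_surj u; have [m [y ->]] := dl_in_surj v.
exists (maxn n m), (ds_map X (leq_maxl n m) x), (ds_map X (leq_maxr n m) y).
by rewrite !dl_in_map.
Qed.

Definition dl_zero : dirlim := dl_in (0 : X 0%N).
Definition dl_opp (u : dirlim) : dirlim := dl_in (- dl_rep u).
Definition dl_scale (a : R) (u : dirlim) : dirlim := dl_in (a *: dl_rep u).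
Definition dl_add (u v : dirlim) : dirlim :=
  dl_in (ds_map X (leq_maxl (dl_rep_deg u) (dl_rep_deg v)) (dl_rep u)
         + ds_map X (leq_maxr (dl_rep_deg u) (dl_rep_deg v)) (dl_rep v)).

Lemma dl_in0 n : dl_in (0 : X n) = dl_zero.
Proof. by apply/dl_inP; exists n, (leqnn n), (leq0n n); rewrite !linear0. Qed.

Lemma dl_inN n (x : X n) : dl_in (- x) = dl_opp (dl_in x).
Proof.
have /dl_inP[k [rk [nk e]]] := dl_repK (dl_in x).
by apply/dl_inP; exists k, nk, rk; rewrite !linearN e.
Qed.

Lemma dl_inZ n a (x : X n) : dl_in (a *: x) = dl_scale a (dl_in x).
Proof.
have /dl_inP[k [rk [nk e]]] := dl_repK (dl_in x).
by apply/dl_inP; exists k, nk, rk; rewrite !linearZ /= e.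
Qed.

Lemma dl_inD n (x y : X n) : dl_in (x + y) = dl_add (dl_in x) (dl_in y).
Proof.
have /dl_inP[k [rk [nk ex]]] := dl_repK (dl_in x).
have /dl_inP[l [sl [nl ey]]] := dl_repK (dl_in y).
have kq := leq_maxl k l; have lq := leq_maxr k l.
apply/dl_inP; exists (maxn k l), (leq_trans nk kq).
have rq := leq_trans rk kq; have sq := leq_trans sl lq.
have mq : (maxn (dl_rep_deg (dl_in x)) (dl_rep_deg (dl_in y)) <= maxn k l)%N.
  by rewrite geq_max rq sq.
exists mq; rewrite !linearD; congr (_ + _).
  by rewrite (ds_map_comp _ _ rq) -(ds_map_comp rk kq) ex; apply/esym/ds_map_comp.
rewrite (ds_map_comp _ _ sq) -(ds_map_comp sl lq) ey; apply/esym/ds_map_comp.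
Qed.

Lemma dl_addA : associative dl_add.
Proof.
move=> u v w; have [n [x [y [-> ->]]]] := dl_in2_surj u v.
have [m [z ->]] := dl_in_surj w.
rewrite -(dl_in_map (leq_maxl n m) x) -(dl_in_map (leq_maxl n m) y).
by rewrite -(dl_in_map (leq_maxr n m) z) -!dl_inD addrA.
Qed.

Lemma dl_addC : commutative dl_add.
Proof.
move=> u v; have [n [x [y [-> ->]]]] := dl_in2_surj u v.
by rewrite -!dl_inD addrC.
Qed.

Lemma dl_add0 : left_id dl_zero dl_add.
Proof.
by move=> u; have [n [x ->]] := dl_in_surj u; rewrite -(dl_in0 n) -dl_inD add0r.
Qed.

Lemma dl_addN : left_inverse dl_zero dl_opp dl_add.
Proof.
move=> u; have [n [x ->]] := dl_in_surj u.
by rewrite -dl_inN -dl_inD addNr dl_in0.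
Qed.

HB.instance Definition _ :=
  GRing.isZmodule.Build dirlim dl_addA dl_addC dl_add0 dl_addN.

Lemma dl_scaleA a b u : dl_scale a (dl_scale b u) = dl_scale (a * b) u.
Proof. by have [n [x ->]] := dl_in_surj u; rewrite -!dl_inZ scalerA. Qed.

Lemma dl_scale1 : left_id 1 dl_scale.
Proof. by move=> u; have [n [x ->]] := dl_in_surj u; rewrite -dl_inZ scale1r. Qed.

Lemma dl_scaleDr : right_distributive dl_scale +%R.
Proof.
move=> a u v; have [n [x [y [-> ->]]]] := dl_in2_surj u v.
by rewrite -[dl_in x + _]dl_inD -!dl_inZ scalerDr dl_inD.
Qed.

Lemma dl_scaleDl u : {morph dl_scale^~ u : a b / a + b}.
Proof.
move=> a b; have [n [x ->]] := dl_in_surj u.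
by rewrite -!dl_inZ scalerDl dl_inD.
Qed.

HB.instance Definition _ := GRing.Zmodule_isLmodule.Build R dirlim
  dl_scaleA dl_scale1 dl_scaleDr dl_scaleDl.

Lemma dl_in_linear n : linear (@dl_in n).
Proof. by move=> a x y; rewrite dl_inD dl_inZ. Qed.

Definition dl_inj n : {linear X n -> dirlim} := mk_linear (@dl_in_linear n).

End DirectLimit.

Section DirectLimitMap.
Variables (R : pzRingType) (X Y : dirsys R).
Variable f : forall n, {linear X n -> Y n}.
Hypothesis f_nat : forall i j (ij : (i <= j)%N) x,
  f j (ds_map X ij x) = ds_map Y ij (f i x).

Definition dl_map_fun (_ : forall i j (ij : (i <= j)%N) x,
  f j (ds_map X ij x) = ds_map Y ij (f i x)) (u : dirlim X) : dirlim Y :=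
  dl_in (f _ (dl_rep u)).

Lemma dl_map_in n (x : X n) : dl_map_fun f_nat (dl_in x) = dl_in (f n x).
Proof.
have /dl_inP[k [rk [nk e]]] := dl_repK (dl_in x).
by apply/dl_inP; exists k, rk, nk; rewrite -!f_nat e.
Qed.

Lemma dl_map_linear : linear (dl_map_fun f_nat).
Proof.
move=> a u v; have [n [x [y [-> ->]]]] := dl_in2_surj u v.
by rewrite -dl_in_linear !dl_map_in linearP dl_in_linear.
Qed.

Definition dl_map : {linear dirlim X -> dirlim Y} := mk_linear dl_map_linear.

End DirectLimitMap.

(* Additive endofunctors of the category of R-modules. *)
Record modfunctor (R : pzRingType) := ModFunctor {
  mf_obj :> lmodType R -> lmodType R;
  mf_map : forall A B : lmodType R,
    {linear A -> B} -> {linear mf_obj A -> mf_obj B};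
  mf_id : forall (A : lmodType R) x, mf_map (idfun : {linear A -> A}) x = x;
  mf_comp : forall (A B C : lmodType R) (g : {linear B -> C})
    (f : {linear A -> B}) x,
    mf_map (g \o f : {linear A -> C}) x = mf_map g (mf_map f x);
  mf_add : forall (A B : lmodType R) (f g : {linear A -> B}) x,
    mf_map (f \+ g : {linear A -> B}) x = mf_map f x + mf_map g x }.

Section IdealTransform.
Variables (R : comNzRingType) (I : ideal R) (M : lmodType R).

Section Object.
Variable N : lmodType R.

Definition transform_res i j (ij : (i <= j)%N) :
    {linear hom (submod (exp_submod I M i)) N
         -> hom (submod (exp_submod I M j)) N} :=
  hom_pre N (submod_incl (@exp_submod_anti _ I M _ _ ij)).

Lemma transform_res_id i (ii : (i <= i)%N) h : transform_res ii h = h.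
Proof.
by apply: hom_eq => x; congr (hom_fun h _); apply: val_inj.
Qed.

Lemma transform_res_comp i j k (ij : (i <= j)%N) (jk : (j <= k)%N)
  (ik : (i <= k)%N) h :
  transform_res jk (transform_res ij h) = transform_res ik h.
Proof.
by apply: hom_eq => x; congr (hom_fun h _); apply: val_inj.
Qed.

Definition transform_sys : dirsys R :=
  DirSys transform_res_id transform_res_comp.

End Object.

Section Morphism.
Variables (A B : lmodType R) (g : {linear A -> B}).

Definition transform_post n : {linear transform_sys A n -> transform_sys B n} :=
  hom_post _ g.

Lemma transform_post_nat i j (ij : (i <= j)%N) (h : transform_sys A i) :
  transform_post j (ds_map (transform_sys A) ij h)
  = ds_map (transform_sys B) ij (transform_post i h).
Proof. exact: hom_eq. Qed.

Definition transform_map :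
    {linear dirlim (transform_sys A) -> dirlim (transform_sys B)} :=
  dl_map transform_post_nat.

End Morphism.

Lemma transform_map_id (A : lmodType R) u :
  transform_map (idfun : {linear A -> A}) u = u.
Proof.
have [n [h ->]] := dl_in_surj u; rewrite [LHS]dl_map_in.
by congr dl_in; exact: hom_eq.
Qed.

Lemma transform_map_comp (A B C : lmodType R) (g : {linear B -> C})
    (f : {linear A -> B}) u :
  transform_map (g \o f : {linear A -> C}) u
  = transform_map g (transform_map f u).
Proof.
have [n [h ->]] := dl_in_surj u; rewrite [LHS]dl_map_in.
rewrite [X in transform_map g X]dl_map_in [RHS]dl_map_in.
by congr dl_in; exact: hom_eq.
Qed.

Lemma transform_map_add (A B : lmodType R) (f g : {linear A -> B}) u :
  transform_map (f \+ g : {linear A -> B}) u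
  = transform_map f u + transform_map g u.
Proof.
have [n [h ->]] := dl_in_surj u; rewrite [LHS]dl_map_in.
rewrite [X in X + _]dl_map_in [X in _ + X]dl_map_in -[RHS]dl_inD.
by congr dl_in; exact: hom_eq.
Qed.

(* The functor N |-> D_I(M, N). *)
Definition gen_ideal_transform : modfunctor R :=
  ModFunctor transform_map_id transform_map_comp transform_map_add.

End IdealTransform.

(* For M = R, the submodule I^n M is the ideal I^n. *)
Definition ideal_transform (R : comNzRingType) (I : ideal R) : modfunctor R :=
  gen_ideal_transform I R^o.

Section Cohomology.
Variables (R : pzRingType) (C : nat -> lmodType R).
Variable d : forall n, {linear C n -> C n.+1}.

Definition coboundaries n : submodClosed (C n) :=
  match n with
  | 0%N => submod0 (C 0%N)
  | m.+1 => im_submod (d m)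
  end.

Definition cocycles n : submodClosed (C n) := ker_submod (d n).

Definition cobound_pred n : submod (cocycles n) -> bool :=
  fun z => submod_val z \in coboundaries n.

Lemma cobound_closed n : submod_closed (@cobound_pred n).
Proof.
split=> [|a x y].
  rewrite -[_ \in _]/(submod_inj (cocycles n) 0 \in coboundaries n).
  by rewrite linear0 rpred0.
rewrite -[x \in _]/(submod_val x \in coboundaries n) => xB.
rewrite -[y \in _]/(submod_val y \in coboundaries n) => yB.
rewrite -[_ \in _]/(submod_inj (cocycles n) (a *: x + y) \in coboundaries n).
by rewrite linearP rpredD ?rpredZ.
Qed.

HB.instance Definition _ n := GRing.isSubmodClosed.Build R _
  (@cobound_pred n) (cobound_closed n).

Definition cohomology n : lmodType R :=
  quomod (GRing.SubmodClosed.clone R _ (@cobound_pred n) _).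

End Cohomology.


Section AdditiveExtension.
Variables G D : zmodType.
Implicit Types (Gamma : set (G * D)) (u v : G * D).
Local Open Scope classical_set_scope.

(* Graphs of additive maps from a subgroup of G to D. *)
Definition addgraph Gamma : Prop :=
  [/\ Gamma 0, forall u v, Gamma u -> Gamma v -> Gamma (u - v)
    & forall y, Gamma (0, y) -> y = 0].

Definition addgraph_value Gamma (b : G) (y : D) : Prop :=
  forall n z, Gamma (b *+ n, z) -> y *+ n = z.

Definition addgraph_adjoin Gamma (w : G * D) : set (G * D) :=
  [set u | exists n : int, Gamma (u - w *~ n)].

Lemma addgraphN Gamma u : addgraph Gamma -> Gamma u -> Gamma (- u).
Proof. by move=> [g0 gB _] gu; rewrite -sub0r; exact: gB. Qed.

Lemma addgraphD Gamma u v :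
  addgraph Gamma -> Gamma u -> Gamma v -> Gamma (u + v).
Proof.
move=> gG gu gv; rewrite -[v]opprK; case: (gG) => _ gB _.
by apply: gB => //; exact: addgraphN.
Qed.

Lemma addgraphMn Gamma u n : addgraph Gamma -> Gamma u -> Gamma (u *+ n).
Proof.
move=> gG gu; elim: n => [|n IH]; first by case: gG.
by rewrite mulrS; exact: addgraphD.
Qed.

Lemma addgraph_adjoin_sub Gamma w : Gamma `<=` addgraph_adjoin Gamma w.
Proof. by move=> u gu; exists 0; rewrite mulr0z subr0. Qed.

Lemma addgraph_adjoin_in Gamma w : addgraph Gamma -> addgraph_adjoin Gamma w w.
Proof. by case=> g0 _ _; exists 1; rewrite mulr1z subrr. Qed.

Lemma pairMn (b : G) (y : D) n : (b, y) *+ n = (b *+ n, y *+ n).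
Proof. by elim: n => [|n IH] //; rewrite !mulrS IH. Qed.

Lemma addgraph_adjoinP Gamma b y : addgraph Gamma ->
  addgraph_value Gamma b y -> addgraph (addgraph_adjoin Gamma (b, y)).
Proof.
move=> gG val; split.
- by apply: addgraph_adjoin_sub; case: gG.
- move=> u v [n gu] [m gv]; exists (n - m).
  rewrite mulrzBr (_ : _ - _ = (u - (b, y) *~ n) - (v - (b, y) *~ m)).
    by case: gG => _ gB _; exact: gB.
  by rewrite !opprD !opprK addrACA.
- move=> z [[n|n] gn].
    have := addgraphN gG gn.
    rewrite -pmulrn pairMn (_ : - _ = (b *+ n, y *+ n - z)).
      by move=> /val/eqP; rewrite -subr_eq0 opprB addrC subrK => /eqP.
    by congr (_, _) => /=; rewrite ?sub0r ?opprK ?opprB.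
  move: gn; rewrite NegzE mulrNz opprK -pmulrn pairMn.
  rewrite (_ : _ + _ = (b *+ n.+1, z + y *+ n.+1)).
    by move=> /val/eqP; rewrite eq_sym -subr_eq0 addrK => /eqP.
  by congr (_, _) => /=; rewrite add0r.
Qed.

Hypothesis D_div : forall n (y : D), (0 < n)%N -> exists x, x *+ n = y.

Lemma addgraph_value_min Gamma b d z : addgraph Gamma ->
  (0 < d)%N -> Gamma (b *+ d, z) ->
  (forall n z', (0 < n)%N -> Gamma (b *+ n, z') -> (d <= n)%N) ->
  forall y, y *+ d = z -> addgraph_value Gamma b y.
Proof.
move=> gG d_gt0 gd dmin y yd n z' gn.
have gr : Gamma (b *+ (n %% d), z' - z *+ (n %/ d)).
  rewrite (_ : (_, _) = (b *+ n, z') - (b *+ d, z) *+ (n %/ d)).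
    case: (gG) => _ gB _; apply: gB => //; exact: addgraphMn.
  rewrite pairMn; congr (_, _) => /=.
  by rewrite -mulrnA {2}(divn_eq n d) mulrnDr mulnC addrAC subrr add0r.
have [r0|r_gt0] := posnP (n %% d)%N; last first.
  by have := dmin _ _ r_gt0 gr; rewrite leqNgt ltn_mod d_gt0.
move: gr; rewrite r0 mulr0n; case: (gG) => _ _ g0 /g0/eqP.
by rewrite subr_eq0 => /eqP->; rewrite -yd -mulrnA mulnC {1}(divn_eq n d) r0 addn0.
Qed.

Lemma addgraph_value_case Gamma b : addgraph Gamma ->
  (exists d z, [/\ (0 < d)%N, Gamma (b *+ d, z) &
     forall n z', (0 < n)%N -> Gamma (b *+ n, z') -> (d <= n)%N])
  \/ (forall y, addgraph_value Gamma b y).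
Proof.
move=> gG; have [ex|nex] := EM (exists n z, (0 < n)%N /\ Gamma (b *+ n, z)).
  left; pose P n := `[< exists z, (0 < n)%N /\ Gamma (b *+ n, z) >].
  have exP : exists n, P n by case: ex => n [z nz]; exists n; apply/asboolP; exists z.
  case: (ex_minnP exP) => d /asboolP[z [d_gt0 gd]] dmin.
  exists d, z; split=> // n z' n_gt0 gn; apply: dmin.
  by apply/asboolP; exists z'.
right=> y [|n] z gn; last by case: nex; exists n.+1, z.
by case: gG => _ _ g0; rewrite (g0 z gn).
Qed.

Lemma addgraph_value_ex Gamma b :
  addgraph Gamma -> exists y, addgraph_value Gamma b y.
Proof.
move=> gG; have [[d [z [d_gt0 gd dmin]]]|any] := addgraph_value_case b gG.
  have [y yd] := D_div z d_gt0; exists y.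
  exact: addgraph_value_min d_gt0 gd dmin y yd.
by exists 0; exact: any.
Qed.

Lemma addgraph_extend Gamma : addgraph Gamma ->
  exists2 g : G -> D, zmod_morphism g & forall u, Gamma u -> g u.1 = u.2.
Proof.
move=> gG; pose P (A : set (G * D)) := addgraph (Gamma `|` A).
have [F FP Ftot|A [PA Amax]] := @Zorn_bigcup _ P.
  split; first by left; case: gG.
    move=> u v [gu|[X FX Xu]] [gv|[Y FY Yv]].
    - by left; case: gG => _ gB _; exact: gB.
    - have [_ gB _] := FP _ FY.
      have [|w] := gB u v (or_introl gu) (or_intror Yv); first by left.
      by right; exists Y.
    - have [_ gB _] := FP _ FX.
      have [|w] := gB u v (or_intror Xu) (or_introl gv); first by left.
      by right; exists X.
    - have [Z FZ [Zu Zv]] : exists2 Z, F Z & Z u /\ Z v.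
        have [XY|YX] := Ftot _ _ FX FY; first by exists Y => //; split=> //; exact: XY.
        by exists X => //; split=> //; exact: YX.
      have [_ gB _] := FP _ FZ.
      have [|w] := gB u v (or_intror Zu) (or_intror Zv); first by left.
      by right; exists Z.
  move=> y [gy|[X FX Xy]]; first by case: gG => _ _; exact.
  by have [_ _ g0] := FP _ FX; apply: g0; right.
have tot b : exists y, (Gamma `|` A) (b, y).
  have [y yval] := addgraph_value_ex b PA; exists y.
  pose B := addgraph_adjoin (Gamma `|` A) (b, y).
  have AB : A `<=` B by move=> u Au; apply: addgraph_adjoin_sub; right.
  have PB : P B.
    rewrite /P (_ : _ `|` _ = B); first exact: addgraph_adjoinP.
    apply/seteqP; split=> [u [gu|//]|u Bu]; last by right.
    by apply: addgraph_adjoin_sub; left.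
  right; apply: contrapT => nA; apply: (Amax B) => //.
  by split=> // BA; apply: nA; apply: BA; exact: addgraph_adjoin_in.
have [g gP] := choice tot.
have [p0 pB puniq] := PA.
exists g => [x y|u gu].
  have := pB _ _ (gP (x - y)) (pB _ _ (gP x) (gP y)).
  rewrite (_ : (_, _) - _ = (0, g (x - y) - (g x - g y))).
    by move=> /puniq/eqP; rewrite subr_eq0 => /eqP.
  by congr (_, _) => /=; rewrite subrr.
have := pB _ _ (gP u.1) (or_introl gu).
rewrite (_ : _ - _ = (0, g u.1 - u.2)).
  by move=> /puniq/eqP; rewrite subr_eq0 => /eqP.
by congr (_, _) => /=; rewrite subrr.
Qed.

End AdditiveExtension.

(* The group Q/Z. *)
Section RatModInt.

Definition int_rat : rat -> bool := fun q => q \is a Num.int.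

Lemma int_rat_closed : zmod_closed int_rat.
Proof.
by split=> [|x y]; rewrite !unfold_in /int_rat; [exact: rpred0|exact: rpredB].
Qed.

HB.instance Definition _ := GRing.isZmodClosed.Build rat int_rat int_rat_closed.

Definition rat_mod_int : zmodType :=
  Quotient.quot (GRing.ZmodClosed.clone rat int_rat _).

Definition to_rmi (q : rat) : rat_mod_int :=
  \pi_(Quotient.quot (GRing.ZmodClosed.clone rat int_rat _)) q.

Lemma to_rmi_surj u : exists q, u = to_rmi q.
Proof. by exists (repr u); rewrite /to_rmi reprK. Qed.

Lemma to_rmiMn q n : to_rmi (q *+ n) = to_rmi q *+ n.
Proof. exact: (raddfMn (\pi_(Quotient.quot (GRing.ZmodClosed.clone rat int_rat _)))). Qed.

Lemma to_rmi_eq0 q : to_rmi q = 0 <-> q \is a Num.int.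
Proof.
have -> : (0 : rat_mod_int) = to_rmi 0.
  by rewrite /to_rmi (raddf0 (\pi_(Quotient.quot (GRing.ZmodClosed.clone rat int_rat _)))).
rewrite /to_rmi; split=> [/eqP|qZ]; first by rewrite -Quotient.idealrBE subr0.
by apply/eqP; rewrite -Quotient.idealrBE subr0.
Qed.

Lemma rat_mod_int_div n (y : rat_mod_int) :
  (0 < n)%N -> exists x, x *+ n = y.
Proof.
move=> n_gt0; have [q ->] := to_rmi_surj y; exists (to_rmi (q / n%:R)).
rewrite -to_rmiMn -[_ / _ *+ n]mulr_natr divfK //.
by rewrite Num.Theory.pnatr_eq0 -lt0n.
Qed.

Lemma rat_mod_int_tors n : (1 < n)%N ->
  exists2 y : rat_mod_int, y != 0 & y *+ n = 0.
Proof.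
move=> n_gt1; have n_neq0 : n%:R != 0 :> rat.
  by rewrite Num.Theory.pnatr_eq0 -lt0n ltnW.
exists (to_rmi n%:R^-1); last first.
  by rewrite -to_rmiMn -[_^-1 *+ n]mulr_natr mulVf //; apply/to_rmi_eq0; exact: rpred1.
apply/eqP => /to_rmi_eq0 /Num.Theory.intrP[m nm].
have := congr1 ( *%R^~ n%:R) nm; rewrite mulVf // -[n%:R]/(n%:~R) -intrM => /eqP.
rewrite (_ : 1 = 1%:~R) // (inj_eq (mulrIz _)) ?oner_neq0 // => /eqP mn.
have : (n %| 1)%Z by apply/dvdzP; exists m.
by rewrite dvdz1 /= => /eqP n1; rewrite n1 in n_gt1.
Qed.

Lemma rat_mod_int_separates (G : zmodType) (b : G) : b != 0 ->
  exists2 g : G -> rat_mod_int, zmod_morphism g & g b != 0.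
Proof.
move=> b_neq0; pose Gamma : set (G * rat_mod_int) := [set 0]%classic.
have gG : addgraph Gamma.
  by split=> [//|u v -> ->|y [->]] //; rewrite subrr.
have [y y_neq0 yval] : exists2 y, y != 0 & addgraph_value Gamma b y.
  have [[d [z [d_gt0 [bd zE] dmin]]]|any] := addgraph_value_case b gG; last first.
    have [y y_neq0 _] := @rat_mod_int_tors 2%N isT.
    by exists y => //; exact: any.
  have d_gt1 : (1 < d)%N.
    case: d d_gt0 bd {dmin} => // -[|//] _ /eqP.
    by rewrite mulr1n (negbTE b_neq0).
  have [y y_neq0 yd] := rat_mod_int_tors d_gt1; exists y => //.
  apply: (@addgraph_value_min _ _ Gamma b d 0) => //.
  by rewrite /Gamma /= bd.
have [g gM gE] := addgraph_extend rat_mod_int_div (addgraph_adjoinP gG yval).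
exists g => //; rewrite (gE (b, y)) //; exact: addgraph_adjoin_in.
Qed.

End RatModInt.

Definition injective_module (R : pzRingType) (E : lmodType R) : Prop :=
  forall (A B : lmodType R) (i : {linear A -> B}) (f : {linear A -> E}),
    injective i -> exists g : {linear B -> E}, forall x, g (i x) = f x.

(* The R-module of functions X -> Hom_Z(R, Q/Z), an injective R-module. Every
   R-module N embeds in the one with X = Hom_Z(N, Q/Z). *)
Section Cofree.
Variables (R : comNzRingType) (X : Type).

Definition cofree_pred : (X * R -> rat_mod_int) -> bool :=
  fun f => `[< forall x, zmod_morphism (fun s => f (x, s)) >].

Lemma cofree_closed : zmod_closed cofree_pred.
Proof.
split=> [|f g]; rewrite !unfold_in.
  by apply/asboolP => x s t; rewrite /= subrr.
move=> /asboolP fM /asboolP gM; apply/asboolP => x s t.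
rewrite -[LHS]/(f (x, s - t) - g (x, s - t)) fM gM.
rewrite -[RHS]/((f (x, s) - g (x, s)) - (f (x, t) - g (x, t))).
by rewrite !opprD addrACA.
Qed.

HB.instance Definition _ :=
  GRing.isZmodClosed.Build (X * R -> rat_mod_int) cofree_pred cofree_closed.

Record cofree := Cofree {
  cofree_val :> X * R -> rat_mod_int;
  cofree_valP : cofree_val \in cofree_pred }.

HB.instance Definition _ := [isSub for cofree_val].
HB.instance Definition _ := [Choice of cofree by <:].
HB.instance Definition _ := [SubChoice_isSubZmodule of cofree by <:].

Lemma cofreeB (f : cofree) x s t : f (x, s - t) = f (x, s) - f (x, t).
Proof. by have /asboolP fM := cofree_valP f; exact: fM. Qed.

Lemma cofree_valD (f g : cofree) u : (f + g) u = f u + g u.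
Proof. by []. Qed.

Lemma cofree_eq (f g : cofree) : f =1 g -> f = g.
Proof. by move=> fg; apply: val_inj; apply: funext. Qed.

Lemma cofree_scale_subproof (a : R) (f : cofree) :
  (fun u => f (u.1, u.2 * a)) \in cofree_pred.
Proof. by apply/asboolP => x s t /=; rewrite mulrBl cofreeB. Qed.

Definition cofree_scale (a : R) (f : cofree) : cofree :=
  Cofree (cofree_scale_subproof a f).

Lemma cofree_scaleA a b f :
  cofree_scale a (cofree_scale b f) = cofree_scale (a * b) f.
Proof. by apply: cofree_eq => -[x s] /=; rewrite mulrA. Qed.

Lemma cofree_scale1 : left_id 1 cofree_scale.
Proof. by move=> f; apply: cofree_eq => -[x s] /=; rewrite mulr1. Qed.

Lemma cofree_scaleDr : right_distributive cofree_scale +%R.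
Proof. by move=> a f g; apply: cofree_eq. Qed.

Lemma cofree_scaleDl f : {morph cofree_scale^~ f : a b / a + b}.
Proof.
move=> a b; apply: cofree_eq => -[x s].
transitivity (f (x, s * a) + f (x, s * b)); last by [].
rewrite -[LHS]/(f (x, s * (a + b))) mulrDr.
have f0 : f (x, 0) = 0 by rewrite -[X in f (x, X)](subrr 0) cofreeB subrr.
have fN t : f (x, - t) = - f (x, t) by rewrite -[X in f (x, X)]sub0r cofreeB f0 sub0r.
by rewrite -[X in f (x, _ + X)]opprK cofreeB fN opprK.
Qed.

HB.instance Definition _ := GRing.Zmodule_isLmodule.Build R cofree
  cofree_scaleA cofree_scale1 cofree_scaleDr cofree_scaleDl.

Lemma cofree_injective : injective_module cofree.
Proof.
move=> A B i f i_inj.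
have ext x : exists g : B -> rat_mod_int,
    zmod_morphism g /\ forall a, g (i a) = f a (x, 1).
  pose Gamma : set (B * rat_mod_int) :=
    [set u | exists a, u = (i a, f a (x, 1))]%classic.
  have gG : addgraph Gamma.
    split=> [|_ _ [a ->] [b ->]|y [a [ia ->]]].
    - by exists 0; rewrite !linear0.
    - by exists (a - b); rewrite !linearB.
    - by rewrite (_ : a = 0) ?linear0 //; apply: i_inj; rewrite linear0.
  have [g gM gE] := addgraph_extend rat_mod_int_div gG.
  by exists g; split=> // a; apply: (gE (i a, f a (x, 1))); exists a.
have [g gP] := choice ext.
have gB x s t : g x (s - t) = g x s - g x t by have [gM _] := gP x; exact: gM.
have h_pred b : (fun u : X * R => g u.1 (u.2 *: b)) \in cofree_pred.
  by apply/asboolP => x s t /=; rewrite scalerBl gB.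
have g0 x : g x 0 = 0 by rewrite -[X in g x X](subrr 0) gB subrr.
have gN x s : g x (- s) = - g x s by rewrite -[X in g x X]sub0r gB g0 sub0r.
have gD x s t : g x (s + t) = g x s + g x t by rewrite -[t]opprK gB gN !opprK.
pose h b := Cofree (h_pred b).
have h_lin : linear h.
  move=> a b c; apply: cofree_eq => -[x s].
  by rewrite cofree_valD /= scalerDr gD scalerA.
exists (mk_linear h_lin) => a; apply: cofree_eq => -[x s] /=.
have [_ gi] := gP x; rewrite -linearZ /= gi linearZ.
by rewrite -[LHS]/(f a (x, 1 * s)) mul1r.
Qed.

End Cofree.

Section InjectiveEmbedding.
Variables (R : comNzRingType) (N : lmodType R).

Definition zdual : Type := {h : N -> rat_mod_int | zmod_morphism h}.

Definition inj_hull : lmodType R := cofree R zdual.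

Lemma inj_embed_subproof (x : N) :
  (fun u : zdual * R => sval u.1 (u.2 *: x)) \in @cofree_pred R zdual.
Proof.
apply/asboolP => -[h hM] s t /=; rewrite scalerBl; exact: hM.
Qed.

Definition inj_embed_fun (x : N) : inj_hull := Cofree (inj_embed_subproof x).

Lemma inj_embed_linear : linear inj_embed_fun.
Proof.
move=> a x y; apply: cofree_eq => -[[h hM] s].
have hB : forall u v, h (u - v) = h u - h v := hM.
have h0 : h 0 = 0 by rewrite -[X in h X](subrr 0) hB subrr.
have hN u : h (- u) = - h u by rewrite -[X in h X]sub0r hB h0 sub0r.
have hD u v : h (u + v) = h u + h v by rewrite -[v in h (u + v)]opprK hB hN opprK.
by rewrite cofree_valD /= scalerDr scalerA hD.
Qed.

Definition inj_embed : {linear N -> inj_hull} := mk_linear inj_embed_linear.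

Lemma inj_embed_inj : injective inj_embed.
Proof.
move=> x y xy; apply/eqP; rewrite -subr_eq0; apply/negP => /negP.
move=> /rat_mod_int_separates[h hM]; rewrite hM subr_eq0 => /negP; apply.
have := congr1 (fun f : inj_hull => f (exist _ h hM : zdual, 1)) xy.
by rewrite /= !scale1r => ->.
Qed.

End InjectiveEmbedding.

Record inj_resolution (R : pzRingType) (N : lmodType R) := InjResolution {
  ir_obj :> nat -> lmodType R;
  ir_d : forall n, {linear ir_obj n -> ir_obj n.+1};
  ir_aug : {linear N -> ir_obj 0%N};
  ir_injective : forall n, injective_module (ir_obj n);
  ir_aug_inj : injective ir_aug;
  ir_exact0 : forall x, ir_d 0%N x = 0 <-> exists y, x = ir_aug y;
  ir_exact : forall n x, ir_d n.+1 x = 0 <-> exists y, x = ir_d n y }.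

Section StandardResolution.
Variables (R : comNzRingType) (N : lmodType R).

Fixpoint cosyzygy (n : nat) : lmodType R :=
  if n is m.+1 then quomod (im_submod (inj_embed (cosyzygy m))) else N.

Definition std_obj (n : nat) : lmodType R := inj_hull (cosyzygy n).

Definition std_proj n : {linear std_obj n -> cosyzygy n.+1} :=
  quomod_proj (im_submod (inj_embed (cosyzygy n))).

Definition std_d n : {linear std_obj n -> std_obj n.+1} :=
  (inj_embed (cosyzygy n.+1) \o std_proj n : {linear std_obj n -> std_obj n.+1}).

Lemma std_d_eq0 n x :
  std_d n x = 0 <-> exists y, x = inj_embed (cosyzygy n) y.
Proof.
have -> : std_d n x = 0 <-> std_proj n x = 0.
  split=> [d0|p0]; last by rewrite /std_d /= p0 linear0.
  by apply: (@inj_embed_inj R (cosyzygy n.+1)); rewrite linear0.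
rewrite -(linear0 (std_proj n)); split.
  by move=> /to_quomodP; rewrite subr0 unfold_in => /asboolP.
by move=> ex; apply/to_quomodP; rewrite subr0 unfold_in; apply/asboolP.
Qed.

Lemma std_exact n x : std_d n.+1 x = 0 <-> exists y, x = std_d n y.
Proof.
rewrite std_d_eq0; split=> [[y ->]|[y ->]]; last by exists (std_proj n y).
by have [z ->] := to_quomod_surj y; exists z.
Qed.

Definition std_resolution : inj_resolution N :=
  InjResolution (fun n => @cofree_injective R (zdual (cosyzygy n)))
    (@inj_embed_inj R N) (std_d_eq0 (n := 0)) std_exact.

End StandardResolution.

Section RightDerived.
Variables (R : comNzRingType) (F : modfunctor R).

(* H^i(F(E)) for an injective resolution E of N; up to isomorphism it does not
   depend on E, and the value R^i F(N) is taken at a fixed choice of E. *)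
Definition derived_along (N : lmodType R) (E : inj_resolution N) (i : nat) :
    lmodType R :=
  cohomology (fun n => mf_map F (ir_d E n)) i.

Definition right_derived (i : nat) (N : lmodType R) : lmodType R :=
  derived_along (std_resolution N) i.

End RightDerived.

Definition prime_ideal (R : comNzRingType) (p : R -> bool) : Prop :=
  idealr_closed p /\ prime_idealr_closed p.

Section Localization.
Variables (R : comNzRingType) (V : lmodType R) (p : R -> bool).
Hypothesis p_prime : prime_ideal p.

Definition loc_den : Type := {s : R | s \notin p}.

Lemma loc_den_mul (s t : loc_den) : sval s * sval t \notin p.
Proof.
case: s t => s sp [t tp] /=; apply/negP => /(p_prime.2 s t)/orP.
by rewrite (negbTE sp) (negbTE tp) => -[].
Qed.

Definition loc_mul (s t : loc_den) : loc_den :=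
  exist (fun r : R => r \notin p) _ (loc_den_mul s t).

Lemma loc_one_subproof : 1 \notin p. Proof. by case: p_prime => -[]. Qed.

Definition loc_one : loc_den :=
  exist (fun r : R => r \notin p) 1 loc_one_subproof.

Definition loc_pre : Type := V * loc_den.
HB.instance Definition _ := Choice.on loc_pre.

Definition loc_eq (u v : loc_pre) : bool :=
  `[< exists w : loc_den, sval w *: (sval v.2 *: u.1 - sval u.2 *: v.1) = 0 >].

Lemma loc_eq_equiv : equiv_class_of loc_eq.
Proof.
split=> [[x s]|[x s] [y t]|[y t] [x s] [z r]].
- by apply/asboolP; exists loc_one; rewrite subrr scaler0.
- by apply/asboolP/asboolP => -[w /= e]; exists w => /=;
    rewrite -opprB scalerN e oppr0.
- move=> /asboolP[w /= e1] /asboolP[w' /= e2]; apply/asboolP.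
  exists (loc_mul (loc_mul w w') t) => /=.
  have -> : (sval w * sval w' * sval t) *: (sval r *: x - sval s *: z) =
      (sval w' * sval r) *: (sval w *: (sval t *: x - sval s *: y))
      + (sval w * sval s) *: (sval w' *: (sval r *: y - sval t *: z)).
    rewrite !scalerBr !scalerA addrA.
    rewrite (_ : sval w' * sval r * sval w * sval s
               = sval w * sval s * sval w' * sval r); last by ring.
    by rewrite subrK; congr (_ *: _ - _ *: _); ring.
  by rewrite e1 e2 !scaler0 addr0.
Qed.

Canonical loc_equivrel := EquivRelPack loc_eq_equiv.

(* The localization of V at the prime p: fractions x / s with s outside p. *)
Definition localization : Type := {eq_quot loc_eq}.
HB.instance Definition _ := Choice.on localization.

Definition loc_frac (x : V) (s : loc_den) : localization :=
  \pi_({eq_quot loc_eq}) (x, s).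

Lemma loc_fracP x s y t : loc_frac x s = loc_frac y t <->
  exists w : loc_den, sval w *: (sval t *: x - sval s *: y) = 0.
Proof.
split=> [/eqmodP/asboolP //|h].
by apply/eqmodP/asboolP.
Qed.

Lemma loc_frac_surj u : exists x s, u = loc_frac x s.
Proof.
have := reprK (u : {eq_quot loc_eq}).
by case: (repr _) => x s <-; exists x, s.
Qed.

Definition loc_num_rep (u : localization) : V := (repr (u : {eq_quot loc_eq})).1.
Definition loc_den_rep (u : localization) : loc_den :=
  (repr (u : {eq_quot loc_eq})).2.

Lemma loc_repK u : loc_frac (loc_num_rep u) (loc_den_rep u) = u.
Proof.
rewrite -[RHS](reprK (u : {eq_quot loc_eq})) /loc_frac /loc_num_rep /loc_den_rep.
by case: (repr _).
Qed.

Definition loc_zero : localization := loc_frac 0 loc_one.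
Definition loc_opp (u : localization) : localization :=
  loc_frac (- loc_num_rep u) (loc_den_rep u).
Definition loc_scale (a : R) (u : localization) : localization :=
  loc_frac (a *: loc_num_rep u) (loc_den_rep u).
Definition loc_add (u v : localization) : localization :=
  loc_frac (sval (loc_den_rep v) *: loc_num_rep u
            + sval (loc_den_rep u) *: loc_num_rep v)
           (loc_mul (loc_den_rep u) (loc_den_rep v)).

Lemma loc_oppE x s : loc_opp (loc_frac x s) = loc_frac (- x) s.
Proof.
have /loc_fracP[w e] := loc_repK (loc_frac x s).
apply/loc_fracP; exists w.
by rewrite !scalerN -opprD scalerN e oppr0.
Qed.

Lemma loc_scaleE a x s : loc_scale a (loc_frac x s) = loc_frac (a *: x) s.
Proof.
have /loc_fracP[w e] := loc_repK (loc_frac x s).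
apply/loc_fracP; exists w; move: e; set s' := loc_den_rep _; set x' := loc_num_rep _.
move=> e; rewrite (_ : _ *: _ = a *: (sval w *: (sval s *: x' - sval s' *: x))).
  by rewrite e scaler0.
by rewrite !scalerBr !scalerA; congr (_ *: _ - _ *: _); ring.
Qed.

Lemma loc_addE x s y t :
  loc_add (loc_frac x s) (loc_frac y t)
  = loc_frac (sval t *: x + sval s *: y) (loc_mul s t).
Proof.
have /loc_fracP[w] := loc_repK (loc_frac x s).
have /loc_fracP[v] := loc_repK (loc_frac y t).
rewrite /loc_add; set s' := loc_den_rep (loc_frac x s).
set x' := loc_num_rep (loc_frac x s).
set t' := loc_den_rep (loc_frac y t); set y' := loc_num_rep (loc_frac y t).
move=> ey ex; apply/loc_fracP; exists (loc_mul w v) => /=.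
rewrite (_ : _ *: _ =
    (sval v * sval t * sval t') *: (sval w *: (sval s *: x' - sval s' *: x))
  + (sval w * sval s * sval s') *: (sval v *: (sval t *: y' - sval t' *: y))).
  by rewrite ex ey !scaler0 addr0.
rewrite !(scalerBr, scalerDr, scalerA) opprD [RHS]addrACA.
by congr (_ *: _ + _ *: _ + (- (_ *: _) - _ *: _)); ring.
Qed.

Lemma loc_fracE (r : loc_den) x s :
  loc_frac (sval r *: x) (loc_mul r s) = loc_frac x s.
Proof.
apply/loc_fracP; exists loc_one => /=.
by rewrite !scalerA mulrC subrr scaler0.
Qed.

Lemma loc_addA : associative loc_add.
Proof.
move=> u v w; have [x [s ->]] := loc_frac_surj u.
have [y [t ->]] := loc_frac_surj v; have [z [r ->]] := loc_frac_surj w.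
rewrite !loc_addE /= (_ : loc_mul s _ = loc_mul (loc_mul s t) r); last first.
  by apply: val_inj; rewrite /= mulrA.
congr loc_frac; rewrite !(scalerDr, scalerA) addrA.
by congr (_ *: _ + _ *: _ + _ *: _); ring.
Qed.

Lemma loc_addC : commutative loc_add.
Proof.
move=> u v; have [x [s ->]] := loc_frac_surj u.
have [y [t ->]] := loc_frac_surj v.
rewrite !loc_addE addrC; congr loc_frac.
by apply: val_inj; rewrite /= mulrC.
Qed.

Lemma loc_add0 : left_id loc_zero loc_add.
Proof.
move=> u; have [x [s ->]] := loc_frac_surj u.
by rewrite /loc_zero loc_addE scaler0 add0r loc_fracE.
Qed.

Lemma loc_addN : left_inverse loc_zero loc_opp loc_add.
Proof.
move=> u; have [x [s ->]] := loc_frac_surj u.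
rewrite loc_oppE loc_addE /= scalerN addNr.
by apply/loc_fracP; exists loc_one; rewrite /= !scaler0 subrr scaler0.
Qed.

HB.instance Definition _ :=
  GRing.isZmodule.Build localization loc_addA loc_addC loc_add0 loc_addN.

Lemma loc_scaleA a b u : loc_scale a (loc_scale b u) = loc_scale (a * b) u.
Proof.
by have [x [s ->]] := loc_frac_surj u; rewrite !loc_scaleE scalerA.
Qed.

Lemma loc_scale1 : left_id 1 loc_scale.
Proof.
by move=> u; have [x [s ->]] := loc_frac_surj u; rewrite loc_scaleE scale1r.
Qed.

Lemma loc_scaleDr : right_distributive loc_scale +%R.
Proof.
move=> a u v; have [x [s ->]] := loc_frac_surj u.
have [y [t ->]] := loc_frac_surj v.
rewrite -![_ + _]/(loc_add _ _) !(loc_addE, loc_scaleE).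
by congr loc_frac; rewrite scalerDr !scalerA ![a * _]mulrC.
Qed.

Lemma loc_scaleDl u : {morph loc_scale^~ u : a b / a + b}.
Proof.
move=> a b; have [x [s ->]] := loc_frac_surj u.
rewrite -[RHS]/(loc_add _ _) !loc_scaleE loc_addE -scalerDr -scalerDl.
by rewrite loc_fracE.
Qed.

HB.instance Definition _ := GRing.Zmodule_isLmodule.Build R localization
  loc_scaleA loc_scale1 loc_scaleDr loc_scaleDl.


End Localization.

Definition Supp (R : comNzRingType) (V : lmodType R) : set (R -> bool) :=
  [set p | exists (p_prime : prime_ideal p) (u : localization V p_prime),
             u != 0]%classic.

Definition fin_gen (R : pzRingType) (M : lmodType R) : Prop :=
  exists (n : nat) (g : 'I_n -> M),
    forall x, exists c : 'I_n -> R, x = \sum_(i < n) c i *: g i.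

Definition noetherian (R : comNzRingType) : Prop :=
  forall J : ideal R, fin_gen (submod J).

(* Main.v *)
(* Fix a prime p outside every Supp (R^i D_I(N)), i <= t. The claim is that
   R^t D_I(M, N) vanishes at p for every finitely generated M, by induction
   on t: a presentation 0 -> K -> R^n -> M -> 0 would give an exact sequence
   R^{t-1} D_I(K, N) -> R^t D_I(M, N) -> R^t D_I(R^n, N) whose outer terms vanish
   at p. The diagram chase is done on cocycles with values in an injective
   resolution of N. Its one non-formal step extends a map from I^m K to
   I^n R^n; Artin-Rees makes this possible, as K meets I^n R^n inside I^m K for
   large n. *)

From HB Require Import structures.
Require Import Defs.
From mathcomp Require Import all_boot all_order all_algebra.
From mathcomp Require Import boolp classical_sets functions cardinality.

Set Implicit Arguments.
Unset Strict Implicit.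
Unset Printing Implicit Defensive.

Import GRing.Theory.
Local Open Scope ring_scope.

(** * Submodules as predicates, and Noetherian modules *)

Section PropSubmodule.
Variables (R : pzRingType) (V : lmodType R).

Definition is_submod (P : V -> Prop) : Prop :=
  P 0 /\ forall a x y, P x -> P y -> P (a *: x + y).

Lemma is_submod_mem (S : submodClosed V) : is_submod (fun x => x \in S).
Proof. by split=> [|a x y Sx Sy]; rewrite ?rpred0 ?rpredD ?rpredZ. Qed.

Section Closure.
Variables (P : V -> Prop) (subP : is_submod P).

Lemma is_submodZ a x : P x -> P (a *: x).
Proof. by move=> Px; rewrite -[_ *: _]addr0; apply: subP.2 => //; case: subP. Qed.

Lemma is_submodD x y : P x -> P y -> P (x + y).
Proof. by move=> Px Py; rewrite -[x]scale1r; apply: subP.2. Qed.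

Lemma is_submodB x y : P x -> P y -> P (x - y).
Proof.
by move=> Px Py; apply: is_submodD => //; rewrite -scaleN1r; exact: is_submodZ.
Qed.

Lemma is_submod_sum n (F : 'I_n -> V) :
  (forall i, P (F i)) -> P (\sum_(i < n) F i).
Proof. by move=> PF; elim/big_ind: _ => //; [case: subP|exact: is_submodD]. Qed.

Definition prop_pred (_ : is_submod P) : V -> bool := fun x => `[< P x >].

Lemma prop_pred_closed : submod_closed (prop_pred subP).
Proof.
split=> [|a x y]; rewrite !unfold_in; first by apply/asboolP; case: subP.
by move=> /asboolP Px /asboolP Py; apply/asboolP; apply: subP.2.
Qed.

HB.instance Definition _ :=
  GRing.isSubmodClosed.Build R V (prop_pred subP) prop_pred_closed.

Definition prop_submod : submodClosed V :=
  GRing.SubmodClosed.clone R V (prop_pred subP) _.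

Lemma prop_submodP x : reflect (P x) (x \in prop_submod).
Proof. exact: asboolP. Qed.

End Closure.

(** Generation by a finite list, phrased as an induction principle over submodules; [spanned_comb]
    recovers coefficients. *)
Definition spanned (P : V -> Prop) (s : seq V) : Prop :=
  (forall x, x \in s -> P x) /\
  forall Q, is_submod Q -> (forall x, x \in s -> Q x) -> forall x, P x -> Q x.

Definition noetherian_module : Prop :=
  forall P, is_submod P -> exists s, spanned P s.

Lemma spanned_comb P s x : spanned P s -> P x ->
  exists c : 'I_(size s) -> R, x = \sum_(i < size s) c i *: s`_i.
Proof.
move=> [_ sQ] Px.
apply: (sQ (fun y => exists c : 'I_(size s) -> R,
  y = \sum_(i < size s) c i *: s`_i)) => //.
  split=> [|a u v [c ->] [d ->]].
    by exists (fun=> 0); rewrite big1 // => i _; rewrite scale0r.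
  exists (fun i => a * c i + d i); rewrite scaler_sumr -big_split /=.
  by apply: eq_bigr => i _; rewrite scalerDl scalerA.
move=> u us; have ui : (index u s < size s)%N by rewrite index_mem.
exists (fun i => if i == Ordinal ui then 1 else 0).
rewrite (bigD1 (Ordinal ui)) //= eqxx scale1r nth_index // big1 ?addr0 // => i.
by move=> /negbTE->; rewrite scale0r.
Qed.

End PropSubmodule.

Lemma submod_val_comb (R : pzRingType) (V : lmodType R) (S : submodClosed V) n
    (c : 'I_n -> R) (g : 'I_n -> submod S) :
  submod_val (\sum_(i < n) c i *: g i) = \sum_(i < n) c i *: submod_val (g i).
Proof.
rewrite [LHS](linear_sum (submod_inj S)); apply: eq_bigr => i _.
by [].
Qed.

Lemma noetherian_regular (R : comNzRingType) :
  noetherian R -> noetherian_module R^o.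
Proof.
move=> noethR P subP; have [n [g gP]] := noethR (prop_submod subP).
exists [seq submod_val (g i) | i <- enum 'I_n]; split.
  by move=> _ /mapP[i _ ->]; apply/(prop_submodP subP); exact: submod_valP.
move=> Q subQ Qg x /(prop_submodP subP) xP.
have [c /(congr1 (@submod_val _ _ _))] := gP (Submod xP).
rewrite submod_val_comb /= => ->; apply: is_submod_sum => // i.
by apply: is_submodZ => //; apply: Qg; apply: map_f; rewrite mem_enum.
Qed.

(** Induction on the number [k] of leading coordinates allowed to be nonzero: the values of the last
    of these form an ideal, whose generators are lifted, and what remains has one coordinate
    fewer. *)
Lemma noetherian_rV (R : comNzRingType) n :
  noetherian R -> noetherian_module 'rV[R]_n.
Proof.
move=> /noetherian_regular noethR.
suff H k : forall P : 'rV[R]_n -> Prop, is_submod P ->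
    (forall x, P x -> forall i : 'I_n, (k <= i)%N -> x 0 i = 0) ->
    exists s, spanned P s.
  by move=> P subP; apply: (H n) => // x _ i; rewrite leqNgt ltn_ord.
elim: k => [|k IH] P subP P0.
  exists [::]; split=> // Q [Q0 _] _ x /P0 x0.
  by rewrite (_ : x = 0) //; apply/rowP => i; rewrite x0 // mxE.
have [kn|nk] := ltnP k n; last first.
  apply: IH => // x /P0 x0 i ki; apply: x0.
  by move: (leq_trans nk ki); rewrite leqNgt ltn_ord.
pose j := Ordinal kn.
pose lead (a : R^o) := exists2 x, P x & x 0 j = a.
have subL : is_submod lead.
  split=> [|a _ _ [x Px <-] [y Py <-]].
    by exists 0; [case: subP|rewrite mxE].
  by exists (a *: x + y); [exact: subP.2|rewrite !mxE].
have [s [sP sQ]] := noethR _ subL.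
have /choice[g gP] (a : R^o) : exists x, lead a -> P x /\ x 0 j = a.
  have [[x Px xa]|nl] := EM (lead a).
    by exists x.
  by exists 0 => /nl.
pose P' x := P x /\ x 0 j = 0.
have subP' : is_submod P'.
  split=> [|a x y [Px x0] [Py y0]].
    by split; [case: subP|rewrite mxE].
  by split; [exact: subP.2|rewrite !mxE x0 y0 mulr0 addr0].
have [r [rP rQ]] : exists s, spanned P' s.
  apply: IH => // x [Px x0] i; rewrite leq_eqVlt => /orP[/eqP ki|].
    by rewrite (_ : i = j) //; exact: val_inj.
  exact: P0.
exists (map g s ++ r); split=> [x|Q subQ Qs x Px].
  rewrite mem_cat => /orP[/mapP[a /sP/gP[Pga _] ->]//|/rP[]//].
(* Some [y] in both submodules agrees with [x] in coordinate [j], so [x - y] lies in [P'], which [r]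
   spans. *)
have [y [Py Qy yx]] : exists y, [/\ P y, Q y & y 0 j = x 0 j].
  apply: (sQ (fun a : R^o => exists y, [/\ P y, Q y & y 0 j = a])).
  - split=> [|a _ _ [u [Pu Qu <-]] [v [Pv Qv <-]]].
      by exists 0; split; [case: subP|case: subQ|rewrite mxE].
    exists (a *: u + v); split; [exact: subP.2|exact: subQ.2|by rewrite !mxE].
  - move=> a sa; exists (g a); have [Pg gE] := gP _ (sP _ sa); split=> //.
    by apply: Qs; rewrite mem_cat map_f.
  - by exists x.
rewrite -(subrK y x); apply: is_submodD => //.
apply: rQ => // [z rz|]; first by apply: Qs; rewrite mem_cat rz orbT.
by split; [exact: is_submodB|rewrite !mxE yx subrr].
Qed.

Lemma fin_gen_kernel (R : comNzRingType) (V W : lmodType R) (f : {linear V -> W}) :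
  noetherian_module V -> fin_gen (submod (ker_submod f)).
Proof.
move=> /(_ _ (is_submod_mem (ker_submod f)))[s sP].
have sK i : (i < size s)%N -> s`_i \in ker_submod f.
  by move=> si; apply: sP.1; exact: mem_nth.
exists (size s), (fun i : 'I_(size s) => Submod (sK i (ltn_ord i))) => x.
have [c xE] := spanned_comb sP (submod_valP x).
exists c; by apply: val_inj; rewrite /= submod_val_comb xE.
Qed.

(** * Products with ideals and powers of an ideal *)

Section IdealSmul.
Variables (R : comNzRingType) (V : lmodType R).

Lemma ideal_smul_mem (J : ideal R) (S : submodClosed V) (a : R) x :
  a \in J -> x \in S -> a *: x \in ideal_smul J S.
Proof.
move=> aJ xS; rewrite unfold_in; apply/asboolP.
by exists 1%N, (fun=> a), (fun=> x); split=> //; rewrite big_ord1.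
Qed.

Lemma ideal_smul_min (J : ideal R) (S : submodClosed V) (Q : V -> Prop) :
  is_submod Q -> (forall a x, a \in J -> x \in S -> Q (a *: x)) ->
  forall x, x \in ideal_smul J S -> Q x.
Proof.
move=> subQ QJ x; rewrite unfold_in => /asboolP[n [a [s [aJ sS ->]]]].
by apply: is_submod_sum => // i; exact: QJ.
Qed.

End IdealSmul.

Lemma exp_submod_min (R : comNzRingType) (I : ideal R) (V : lmodType R) n
    (Q : V -> Prop) :
  is_submod Q -> (forall a x, a \in ideal_exp I n -> Q (a *: x)) ->
  forall x, x \in exp_submod I V n -> Q x.
Proof. by move=> subQ QI; apply: ideal_smul_min => // a x aI _; exact: QI. Qed.

Lemma exp_submod_linear (R : comNzRingType) (I : ideal R) (V W : lmodType R)
    (f : {linear V -> W}) n x :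
  x \in exp_submod I V n -> f x \in exp_submod I W n.
Proof.
apply: (exp_submod_min (Q := fun x => f x \in _)) => [|a y an]; last first.
  by rewrite linearZ ideal_smul_mem.
by split=> [|a u v fu fv]; rewrite ?linear0 ?rpred0 // linearP rpredD ?rpredZ.
Qed.

Lemma exp_submod_lift (R : comNzRingType) (I : ideal R) (V W : lmodType R)
    (f : {linear V -> W}) n y : (forall y, exists x, f x = y) ->
  y \in exp_submod I W n -> exists2 x, x \in exp_submod I V n & f x = y.
Proof.
move=> f_surj.
apply: (exp_submod_min (Q := fun y => exists2 x, _ & f x = y)) => [|a z an].
  split=> [|a _ _ [u uV <-] [v vV <-]]; first by exists 0; rewrite ?rpred0 ?linear0.
  by exists (a *: u + v); rewrite ?linearP // rpredD ?rpredZ.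
have [x <-] := f_surj z; exists (a *: x); last exact: linearZ.
exact: ideal_smul_mem.
Qed.

Lemma exp_in_ideal_exp (R : comNzRingType) (I : ideal R) (a : R) m :
  a \in I -> a ^+ m \in ideal_exp I m.
Proof.
by move=> aI; elim: m => // m IH; rewrite exprS; exact: ideal_smul_mem.
Qed.

(** Pigeonhole: a long word either contains [b] at least [k] times, and then [b ^+ k] factors out,
    or still has many letters from the rest of the list. *)
Lemma words_absorbed (R : comNzRingType) (Q : R^o -> Prop) k (s : seq R) :
  is_submod Q -> (forall a, a \in s -> Q (a ^+ k)) ->
  exists n, forall w : seq R, (n <= size w)%N -> {subset w <= s} ->
    Q (\prod_(a <- w) a).
Proof.
move=> subQ; elim: s => [|b s IH] sQ.
  (* With no letters available, no word has length 1 or more; the bound 0 would admit the empty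
     word, of product 1. *)
  exists 1%N => -[|a w] // _ /(_ a); rewrite mem_head => /(_ isT) //.
have [n nP] := IH (fun a as_ => sQ a (mem_behead (s := b :: s) as_)).
exists (n + k)%N => w wn ws; rewrite (bigID (pred1 b)) /=.
have cnt := count_predC (pred1 b) w.
have [bk|kb] := leqP k (count (pred1 b) w).
  rewrite (eq_bigr (fun=> b)) => [|a /eqP//].
  rewrite big_const_seq iter_mulr_1 -(subnK bk) exprD mulrAC.
  by apply: (is_submodZ subQ); apply: sQ; rewrite mem_head.
rewrite -[X in _ * X]big_filter; apply: (is_submodZ subQ); apply: nP.
  rewrite size_filter -(leq_add2r k) (leq_trans wn) // -cnt addnC leq_add2l.
  exact: ltnW.
by move=> a; rewrite mem_filter => /andP[/= ab /ws]; rewrite inE (negbTE ab).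
Qed.

(** Products of [n] generators span I^n; the induction peels off one factor of I at a time. *)
Lemma exp_absorbed (R : comNzRingType) (I : ideal R) (s : seq R^o) n
    (Q : R^o -> Prop) :
  spanned (fun a => a \in I) s -> is_submod Q ->
  (forall w : seq R, (n <= size w)%N -> {subset w <= s} -> Q (\prod_(a <- w) a)) ->
  forall a, a \in ideal_exp I n -> Q a.
Proof.
move=> [_ sI]; elim: n Q => [|n IH] Q subQ wQ.
  move=> a _; rewrite -[a]mulr1; apply: (is_submodZ subQ).
  by rewrite -(big_nil 1 *%R xpredT id); apply: wQ.
apply: (ideal_smul_min subQ) => a b aI bI.
(* The elements that multiply I^n into [Q] form a submodule, so only generators [c] of I need
   checking. *)
pose Q' (c : R^o) := forall e : R^o, e \in ideal_exp I n -> Q (c * e).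
apply: (sI Q') aI b bI => [|c cs].
  split=> [e _|x c d Qc Qd e eI]; first by rewrite mul0r; case: subQ.
  rewrite mulrDl; apply: (is_submodD subQ); last exact: Qd.
  by rewrite -scalerAl; apply: (is_submodZ subQ); apply: Qc.
apply: IH => [|w nw ws].
  split=> [|x u v Qu Qv]; first by rewrite mulr0; case: subQ.
  rewrite mulrDr; apply: (is_submodD subQ) => //.
  by rewrite -scalerAr; apply: (is_submodZ subQ).
rewrite -(big_cons _ _ _ _ xpredT id); apply: wQ => // e.
by rewrite inE => /orP[/eqP->//|/ws].
Qed.

(** * A weak form of the Artin-Rees lemma *)

Section ArtinRees.
Variables (R : comNzRingType) (I : ideal R) (V : lmodType R) (K : submodClosed V).
Hypotheses (noethR : noetherian R) (noethV : noetherian_module V).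
Variable m : nat.

Let JK := ideal_smul (ideal_exp I m) K.

(* If [a ^+ k *: v] is in [L] for a [k] that may depend on [v], then a single
   [k] works, and adding [a ^+ k V] to [L] leaves its trace on [K] unchanged. *)
Lemma artin_rees_step (L : V -> Prop) a : a \in I -> is_submod L ->
  (forall x, x \in JK -> L x) -> (forall x, L x -> x \in K -> x \in JK) ->
  exists L' : V -> Prop, [/\ is_submod L', forall x, L x -> L' x,
    forall x, L' x -> x \in K -> x \in JK & exists k, forall v, L' (a ^+ k *: v)].
Proof.
move=> aI subL JKL LK.
pose U v := exists k, L (a ^+ k *: v).
have up k l v : (k <= l)%N -> L (a ^+ k *: v) -> L (a ^+ l *: v).
  move=> /subnK<- Lv; rewrite exprD -scalerA; exact: (is_submodZ subL).
have sub_k k : is_submod (fun v => L (a ^+ k *: v)).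
  split=> [|c x y Lx Ly]; first by rewrite scaler0; case: subL.
  by rewrite scalerDr scalerA mulrC -scalerA; apply: subL.2.
have subU : is_submod U.
  split=> [|c x y [k Lx] [l Ly]]; first by exists 0%N; case: (sub_k 0%N).
  exists (k + l)%N; apply: (sub_k _).2.
    by apply: up Lx; exact: leq_addr.
  by apply: up Ly; exact: leq_addl.
(* [U] is finitely generated, which makes the exponent uniform. *)
have [s [sU sQ]] := noethV subU.
have [k kU] : exists k, forall v, U v -> L (a ^+ k *: v).
  have [k ks] : exists k, forall v, v \in s -> L (a ^+ k *: v).
    elim: s sU {sQ} => [|u s IH] sU; first by exists 0%N.
    have [k ks] := IH (fun v vs => sU v (mem_behead (s := u :: s) vs)).
    have [l Lu] := sU u (mem_head _ _).
    exists (k + l)%N => v; rewrite inE => /orP[/eqP->|/ks Lv].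
      by apply: up Lu; exact: leq_addl.
    by apply: up Lv; exact: leq_addr.
  by exists k; apply: sQ.
exists (fun v => exists l u, L l /\ v = l + a ^+ k *: u); split.
- split=> [|c _ _ [l [u [Ll ->]]] [l' [u' [Ll' ->]]]].
    by exists 0, 0; split; [case: subL|rewrite scaler0 addr0].
  exists (c *: l + l'), (c *: u + u'); split; first exact: subL.2.
  by rewrite !scalerDr !scalerA (mulrC c) addrACA.
- by move=> v Lv; exists v, 0; rewrite scaler0 addr0.
- move=> x [l [u [Ll xE]]] xK; apply: LK => //; rewrite xE.
  (* Since [x] is in [K], [a ^+ m *: x] is in [JK], hence in [L]; subtracting [a ^+ m *: l] puts
     [a ^+ (m + k) *: u] in [L], so [u] is in [U]. *)
  apply: (is_submodD subL) => //; apply: kU; exists (m + k)%N.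
  rewrite exprD -scalerA -[_ ^+ k *: u](addKr l) -xE addrC scalerBr.
  apply: (is_submodB subL); last exact: (is_submodZ subL).
  by apply: JKL; apply: ideal_smul_mem => //; exact: exp_in_ideal_exp.
- by exists k => v; exists 0, v; rewrite add0r; split=> //; case: subL.
Qed.

(** Start from [JK] and treat the generators of I one at a time. The resulting [L] still meets [K]
    inside [JK], and it contains some I^n V because long words in the generators send V into [L]. *)
Lemma artin_rees : exists n, forall x, x \in exp_submod I V n -> x \in K -> x \in JK.
Proof.
have [s sI] := noetherian_regular noethR (is_submod_mem I).
have [L [subL LK [k Ls]]] : exists L : V -> Prop, [/\ is_submod L,
    forall x, L x -> x \in K -> x \in JK &
    exists k, forall a v, a \in s -> L (a ^+ k *: v)].
  suff: exists L : V -> Prop, [/\ is_submod L, forall x, x \in JK -> L x,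
      forall x, L x -> x \in K -> x \in JK &
      exists k, forall a v, a \in s -> L (a ^+ k *: v)].
    by case=> L [subL _ LK Ls]; exists L.
  case: sI => sI _; elim: s sI => [_|a s IH sI].
    exists (fun x => x \in JK); split=> //; first exact: is_submod_mem.
    by exists 0%N.
  have [L [subL JKL LK [k Ls]]] := IH (fun v vs => sI v (mem_behead (s := a :: s) vs)).
  have [L' [subL' LL' LK' [l L'a]]] :=
    artin_rees_step (sI a (mem_head _ _)) subL JKL LK.
  exists L'; split=> // [x /JKL/LL'//|]; exists (k + l)%N => b v.
  rewrite inE => /orP[/eqP->|bs].
    by rewrite addnC exprD -scalerA.
  by rewrite exprD -scalerA; apply/LL'/Ls.
pose Q (a : R^o) := forall v, L (a *: v).
have subQ : is_submod Q.
  split=> [v|c a b Qa Qb v]; first by rewrite scale0r; case: subL.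
  by rewrite scalerDl -scalerA; apply: subL.2.
have [n nQ] := words_absorbed subQ (fun a as_ v => Ls a v as_).
exists n => x xI; apply: LK; move: xI; apply: exp_submod_min => // a v an.
exact: (exp_absorbed sI subQ nQ).
Qed.

End ArtinRees.

(** * Functions that are linear on a submodule only *)

Definition linear_on (R : pzRingType) (V W : lmodType R) (S : submodClosed V)
    (f : V -> W) : Prop :=
  forall a x y, x \in S -> y \in S -> f (a *: x + y) = a *: f x + f y.

(** Links two readings of JK, inside V and inside the module K itself: Artin-Rees yields the first,
    maps defined on I^m K need the second. *)
Lemma smul_submod_lift (R : comNzRingType) (V : lmodType R) (J : ideal R)
    (K : submodClosed V) x : x \in ideal_smul J K ->
  exists2 z : submod K, z \in ideal_smul J (submodT (submod K)) & submod_val z = x.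
Proof.
apply: (ideal_smul_min (Q := fun x => exists2 z : submod K, _ & submod_val z = x)).
  split=> [|a _ _ [u uJ <-] [v vJ <-]]; first by exists 0; rewrite ?rpred0.
  by exists (a *: u + v); rewrite ?rpredD ?rpredZ.
by move=> a y aJ yK; exists (a *: Submod yK); rewrite ?ideal_smul_mem.
Qed.

Section LinearOn.
Variables (R : pzRingType) (V W : lmodType R) (S : submodClosed V) (f : V -> W).
Hypothesis linf : linear_on S f.

Lemma linear_on0 : f 0 = 0.
Proof.
have := linf (- 1) (rpred0 S) (rpred0 S).
by rewrite scaleN1r oppr0 addr0 scaleN1r addNr.
Qed.

Lemma linear_onZ a x : x \in S -> f (a *: x) = a *: f x.
Proof. by move=> xS; rewrite -[a *: x]addr0 linf ?rpred0 // linear_on0 addr0. Qed.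

Lemma linear_onD x y : x \in S -> y \in S -> f (x + y) = f x + f y.
Proof. by move=> xS yS; rewrite -[x in LHS]scale1r linf // scale1r. Qed.

Lemma linear_onB x y : x \in S -> y \in S -> f (x - y) = f x - f y.
Proof.
move=> xS yS; rewrite -[- y]scaleN1r linear_onD ?rpredZ // linear_onZ //.
by rewrite scaleN1r.
Qed.

Lemma linear_on_sum n (x : 'I_n -> V) : (forall i, x i \in S) ->
  f (\sum_(i < n) x i) = \sum_(i < n) f (x i).
Proof.
move=> xS.
suff [] : \sum_(i < n) x i \in S /\ f (\sum_(i < n) x i) = \sum_(i < n) f (x i) by [].
apply: (big_ind2 (fun u v => u \in S /\ f u = v)) => //.
- by rewrite rpred0 linear_on0.
- by move=> u _ v _ [uS <-] [vS <-]; rewrite rpredD // linear_onD.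
Qed.

Lemma linear_on_sub (T : submodClosed V) :
  {subset T <= S} -> linear_on T f.
Proof. by move=> TS a x y /TS xS /TS yS; exact: linf. Qed.

End LinearOn.

(** * Exactness of ideal transforms at a prime *)

Section Killed.
Variables (R : comNzRingType) (I : ideal R) (p : R -> bool).
Hypothesis p_prime : prime_ideal p.

(* The middle cohomology of D_I(M, A) -> D_I(M, B) -> D_I(M, C) vanishes at p.
   Elements of D_I(M, B) are represented by functions M -> B, of which only the
   restriction to some I^n M matters. *)
Definition exact_at (M A B C : lmodType R) (a : {linear A -> B})
    (b : {linear B -> C}) : Prop :=
  forall n (h : M -> B), linear_on (exp_submod I M n) h ->
    (forall x, x \in exp_submod I M n -> b (h x) = 0) ->
  exists s m (k : M -> A), [/\ s \notin p, linear_on (exp_submod I M m) k &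
    forall x, x \in exp_submod I M m -> a (k x) = s *: h x].

Lemma notin_primeM s t : s \notin p -> t \notin p -> s * t \notin p.
Proof.
move=> sp tp; apply/negP => /(p_prime.2 s t)/orP.
by rewrite (negbTE sp) (negbTE tp) => -[].
Qed.

Lemma notin_prime1 : 1 \notin p. Proof. by case: p_prime => -[]. Qed.

(** Take the product of the denominators, which avoids [p] by primality, and the maximum of the
    exponents. *)
Lemma common_denominator n (P : 'I_n -> R -> nat -> Prop) :
  (forall i r s m m', (m <= m')%N -> P i s m -> P i (r * s) m') ->
  (forall i, exists s m, s \notin p /\ P i s m) ->
  exists s m, s \notin p /\ forall i, P i s m.
Proof.
move=> Pmono /choice[s /choice[m smP]].
exists (\prod_i s i), (\max_i m i); split.
  elim/big_ind: _ => [|x y|i _]; [exact: notin_prime1|exact: notin_primeM|].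
  by case: (smP i).
move=> i; rewrite (bigD1 i) //= mulrC; apply: Pmono (smP i).2.
exact: leq_bigmax.
Qed.

Section ExactAt.
Variables (A B C : lmodType R) (a : {linear A -> B}) (b : {linear B -> C}).

(** D_I(R^n, -) is a finite direct sum of copies of D_I(R, -): solve along each inclusion [iota j]
    and add up the solutions composed with the projections. *)
Lemma exact_at_rV n : exact_at R^o a b -> exact_at 'rV[R]_n a b.
Proof.
move=> exR n0 h linh bh.
pose iota_fun j (r : R^o) : 'rV[R]_n := r *: delta_mx 0 j.
have iota_lin j : linear (iota_fun j).
  by move=> c x y; rewrite /iota_fun scalerDl scalerA.
pose iota j : {linear R^o -> 'rV[R]_n} := mk_linear (iota_lin j).
pose pr_fun j (x : 'rV[R]_n) : R^o := x 0 j.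
have pr_lin j : linear (pr_fun j) by move=> c x y; rewrite /pr_fun !mxE.
pose pr j : {linear 'rV[R]_n -> R^o} := mk_linear (pr_lin j).
pose P (j : 'I_n) s m := exists k : R^o -> A,
  linear_on (exp_submod I R^o m) k /\
  forall x, x \in exp_submod I R^o m -> a (k x) = s *: h (iota j x).
have [s [m0 [sp smP]]] : exists s m, s \notin p /\ forall j, P j s m.
  apply: common_denominator => [j r s m m' mm' [k [link ak]]|j].
    exists (fun x => r *: k x); split=> [c x y xm ym|x xm].
      have sub := exp_submod_anti mm'.
      by rewrite link ?sub // scalerDr !scalerA (mulrC c).
    by rewrite linearZ /= ak ?scalerA // (exp_submod_anti mm').
  have [|x xn|s [m [k [sp link ak]]]] := exR n0 (h \o iota j); first 1 last.
  - by apply: bh; exact: (exp_submod_linear (iota j)).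
  - by exists s, m; split=> //; exists k.
  - by move=> c x y xn yn; rewrite /= linearP linh //;
      exact: (exp_submod_linear (iota j)).
have [k kP] := choice smP.
(* [m0] makes each [k j] linear and a solution; [n0] lets [h] split over the coordinates of [x]. *)
pose m := maxn n0 m0.
have subn0 := exp_submod_anti (I := I) (M := 'rV[R]_n) (leq_maxl n0 m0).
have subm0 := exp_submod_anti (I := I) (M := R^o) (leq_maxr n0 m0).
exists s, m, (fun x => \sum_(j < n) k j (pr j x)); split=> // [c x y xm ym|x xm].
  rewrite scaler_sumr -big_split /=; apply: eq_bigr => j _.
  by rewrite linearP (kP j).1 //; apply: subm0; apply: exp_submod_linear.
rewrite linear_sum [in RHS](row_sum_delta x) (linear_on_sum linh) => [|j].
  rewrite scaler_sumr; apply: eq_bigr => j _.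
  by rewrite (kP j).2 //; apply: subm0; apply: exp_submod_linear.
apply: subn0; apply: (exp_submod_linear (iota j)).
exact: (exp_submod_linear (pr j)).
Qed.

End ExactAt.

(** The chase for 0 -> K -> F -> M -> 0: pull [h] back to F and solve there by [k]; correct a
    multiple of [k] by [a \o g] so that it vanishes on the part of K in I^N F, then descend to M. *)
Lemma exact_at_quotient (A B C D : lmodType R) (a : {linear A -> B})
    (b : {linear B -> C}) (c : {linear C -> D}) (F M : lmodType R)
    (f : {linear F -> M}) :
  noetherian R -> noetherian_module F -> injective_module A ->
  (forall x, b (a x) = 0) -> (forall y, exists x, f x = y) ->
  exact_at (submod (ker_submod f)) a b -> exact_at F b c -> exact_at M b c.
Proof.
move=> noethR noethF injA ba0 f_surj exK exF n h linh ch.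
pose K := ker_submod f.
have [|x xn|s [m [k [sp link bk]]]] := exF n (h \o f).
- by move=> r x y xn yn; rewrite /= linearP linh //; exact: exp_submod_linear.
- by apply: ch; exact: exp_submod_linear.
have inF i x : x \in exp_submod I (submod K) i -> submod_val x \in exp_submod I F i.
  exact: (exp_submod_linear (submod_inj K)).
have h0 := linear_on0 linh.
(* On K the map [k] is killed by [b], as [h \o f] vanishes there, so [k] comes from A up to the
   factor [s']. *)
have [|x xm|s' [m' [l [s'p linl al]]]] := exK m (k \o @submod_val _ _ K).
- by move=> r x y xm ym; rewrite /= -link ?inF.
- rewrite /= bk ?inF //=; have /eqP-> : f (submod_val x) == 0 := submod_valP x.
  by rewrite h0 scaler0.
(* [l] is known to be linear only on I^m' K; injectivity of A extends it from there to all of F. *)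
pose T := exp_submod I (submod K) m'.
pose i : {linear submod T -> F} := submod_inj K \o submod_inj T.
have i_inj : injective i by move=> x y xy; do 2!apply: val_inj.
have lT_lin : linear (fun x : submod T => l (submod_val x)).
  by move=> r x y; rewrite /= linl //; exact: submod_valP.
have [g gP] := injA _ _ i (mk_linear lT_lin) i_inj.
(* For this [q], K meets I^q F inside I^m' K, where [g] agrees with [l] and so [a \o g] equals
   [s' *: k]. *)
have [q qP] := @artin_rees R I F K noethR noethF m'.
pose N := maxn m q.
have sub_m := exp_submod_anti (I := I) (M := F) (leq_maxl m q : m <= N)%N.
have sub_q := exp_submod_anti (I := I) (M := F) (leq_maxr m q : q <= N)%N.
pose k' x := s' *: k x - a (g x).
have link' : linear_on (exp_submod I F N) k'.
  move=> r x y xN yN; rewrite /k' link ?sub_m // (linearP g) (linearP a).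
  by rewrite scalerDr opprD addrACA scalerBr !scalerA (mulrC r).
have k'K x : x \in exp_submod I F N -> f x = 0 -> k' x = 0.
  move=> xN /eqP xK; have [z zT <-] := smul_submod_lift (qP x (sub_q _ xN) xK).
  have := gP (Submod zT); rewrite /k' /= => ->.
  by rewrite al //= subrr.
(* A set-theoretic section of [f] over I^N M. It need not be linear, but [k' \o u] is, since [k']
   vanishes on differences of lifts. *)
have /choice[u uP] (y : M) : exists x, y \in exp_submod I M N ->
    x \in exp_submod I F N /\ f x = y.
  have [yN|] := boolP (y \in exp_submod I M N); last by exists 0.
  by have [x xN fx] := exp_submod_lift f_surj yN; exists x.
exists (s' * s), N, (k' \o u); split; first exact: notin_primeM.
  move=> r x y xN yN /=.
  have [uxN fux] := uP _ xN; have [uyN fuy] := uP _ yN.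
  have [uN fu] := uP (r *: x + y) (rpredD (rpredZ r xN) yN).
  rewrite -link' //; apply/eqP; rewrite -subr_eq0.
  rewrite -(linear_onB link') ?rpredD ?rpredZ //.
  by rewrite k'K ?rpredB ?rpredD ?rpredZ // linearB linearP fu fux fuy subrr.
move=> y yN; have [uN fu] := uP _ yN.
rewrite /= /k' linearB linearZ /= ba0 subr0 bk ?sub_m //= fu.
by rewrite scalerA.
Qed.
End Killed.

(** * Elements of D_I(M, B) as functions on M *)

Section Transform.
Variables (R : comNzRingType) (I : ideal R) (M : lmodType R).

Let F := gen_ideal_transform I M.

Definition represents (B : lmodType R) (u : F B) n (f : M -> B) : Prop :=
  exists2 h : transform_sys I M B n, u = dl_in h &
    forall x, hom_fun h x = f (submod_val x).

Lemma represents_exists (B : lmodType R) (u : F B) :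
  exists n f, linear_on (exp_submod I M n) f /\ represents u n f.
Proof.
have [n [h ->]] := dl_in_surj u.
(* The value 0 outside I^n M is arbitrary: linearity is only asked inside. *)
pose f x := if pselect (x \in exp_submod I M n) is left xn
  then hom_fun h (Submod xn) else 0.
have fE (x : submod (exp_submod I M n)) : f (submod_val x) = hom_fun h x.
  rewrite /f; case: pselect => [xn|]; last by case; exact: submod_valP.
  by congr hom_fun; exact: val_inj.
exists n, f; split; last by exists h.
move=> a x y xn yn.
by have := hom_linear h a (Submod xn) (Submod yn); rewrite -!fE.
Qed.

Lemma represented (B : lmodType R) n (f : M -> B) :
  linear_on (exp_submod I M n) f -> exists u : F B, represents u n f.
Proof.
move=> linf.
have lin : linear (fun x : submod (exp_submod I M n) => f (submod_val x)).
  by move=> a x y /=; rewrite linf //; exact: submod_valP.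
pose h : transform_sys I M B n := lin_hom (mk_linear lin).
by exists (dl_in h), h.
Qed.

Lemma represents_eq (B : lmodType R) (u v : F B) n m (f g : M -> B) :
  represents u n f -> represents v m g ->
  u = v <-> exists k, [/\ (n <= k)%N, (m <= k)%N &
    forall x, x \in exp_submod I M k -> f x = g x].
Proof.
move=> [h -> hf] [h' -> hg]; rewrite dl_inP.
split=> [[k [nk [mk e]]]|[k [nk mk fg]]].
  exists k; split=> // x xk.
  have := congr1 (fun h : transform_sys I M B k => hom_fun h (Submod xk)) e.
  by rewrite [LHS]hf [RHS]hg.
exists k, nk, mk; apply: hom_eq => x; rewrite [LHS]hf [RHS]hg.
by apply: fg; exact: submod_valP.
Qed.

Lemma represents_map (A B : lmodType R) (g : {linear A -> B}) (u : F A) n f :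
  represents u n f -> represents (mf_map F g u) n (g \o f).
Proof.
move=> [h -> hf]; exists (transform_post I M g n h); first exact: dl_map_in.
by move=> x; rewrite [RHS]/= -hf.
Qed.

Lemma represents_scale (B : lmodType R) s (u : F B) n f :
  represents u n f -> represents (s *: u) n (fun x => s *: f x).
Proof.
move=> [h -> hf]; exists (s *: h); last by move=> x; rewrite -hf.
exact/esym/dl_inZ.
Qed.

Lemma represents0 (B : lmodType R) : represents (0 : F B) 0 (fun=> 0).
Proof. by exists 0 => //; exact/esym/dl_in0. Qed.

(** Moves between functions and the direct limit: an equality in the limit holds on some smaller I^k
    M, so exponents are enlarged as needed. *)
Lemma exact_atP (p : R -> bool) (A B C : lmodType R) (a : {linear A -> B})
    (b : {linear B -> C}) :
  exact_at I p M a b <->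
  forall u, mf_map F b u = 0 -> exists s v, s \notin p /\ s *: u = mf_map F a v.
Proof.
split=> [ex u bu|ex n h linh bh].
  have [n [h [linh uh]]] := represents_exists u.
  have [m [nm _ bh]] := (represents_eq (represents_map b uh) (represents0 C)).1 bu.
  have linh' := linear_on_sub linh (exp_submod_anti nm).
  have [s [l [k [sp link ak]]]] := ex m h linh' bh.
  have [v vk] := represented link; exists s, v; split=> //.
  apply/(represents_eq (represents_scale s uh) (represents_map a vk)).
  exists (maxn n l); split=> [||x xnl]; rewrite ?leq_maxl ?leq_maxr //= ak //.
  exact: (exp_submod_anti (leq_maxr n l)) xnl.
have [u uh] := represented linh.
have [|s [v [sp e]]] := ex u.
  by apply/(represents_eq (represents_map b uh) (represents0 C)); exists n.
have [m [k [link vk]]] := represents_exists v.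
have [l [nl ml ak]] :=
  (represents_eq (represents_scale s uh) (represents_map a vk)).1 e.
exists s, l, k; split=> // [|x /ak //].
by apply: (linear_on_sub link); exact: exp_submod_anti.
Qed.

End Transform.

(** * Vanishing of a module and of cohomology at a prime *)

Lemma notin_SuppP (R : comNzRingType) (V : lmodType R) (p : R -> bool) :
  prime_ideal p ->
  ~ Supp V p <-> forall x : V, exists s, s \notin p /\ s *: x = 0.
Proof.
move=> p_prime; split=> [nSupp x|torsion [p_prime' [u /eqP[]]]].
  (* The fraction x/1 is zero only if some element outside [p] kills [x]. *)
  pose u := loc_frac p_prime x (loc_one p_prime).
  have /loc_fracP[w] : u = 0.
    by apply: contrapT => /eqP u0; apply: nSupp; exists p_prime, u.
  rewrite /= scale1r scaler0 subr0 => wx; exists (sval w); split=> //.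
  exact: (valP w).
have [x [s ->]] := loc_frac_surj u; have [r [rp rx]] := torsion x.
apply/loc_fracP; exists (exist _ r rp).
by rewrite /= scale1r scaler0 subr0.
Qed.

Lemma to_quomodZ_eq0 (R : pzRingType) (V : lmodType R) (S : submodClosed V) a x :
  a *: to_quomod S x = 0 <-> a *: x \in S.
Proof.
have <- : to_quomod S 0 = 0 := linear0 (quomod_proj S).
by rewrite -[LHS]/(quomod_scale a (to_quomod S x)) -to_quomodZ to_quomodP subr0.
Qed.

Lemma cohomology_torsionP (R : comNzRingType) (p : R -> bool) (C : nat -> lmodType R)
    (d : forall n, {linear C n -> C n.+1}) n :
  (forall x : cohomology d n, exists s, s \notin p /\ s *: x = 0) <->
  forall z, d n z = 0 -> exists s, s \notin p /\ s *: z \in coboundaries d n.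
Proof.
split=> [tors z dz|tors x].
  have zZ : z \in cocycles d n by apply/eqP.
  have [s [sp /to_quomodZ_eq0 sz]] := tors (to_quomod _ (Submod zZ)).
  by exists s.
have [[z zZ] ->] := to_quomod_surj x.
have [s [sp sz]] := tors z (eqP zZ); exists s; split=> //.
exact/to_quomodZ_eq0.
Qed.

Lemma fin_gen_surj (R : comNzRingType) (M : lmodType R) : fin_gen M ->
  exists n (f : {linear 'rV[R]_n -> M}), forall y, exists x, f x = y.
Proof.
move=> [n [g gP]].
have f_lin : linear (fun c : 'rV[R]_n => \sum_(i < n) c 0 i *: g i).
  move=> a x y; rewrite scaler_sumr -big_split /=; apply: eq_bigr => i _.
  by rewrite !mxE scalerDl scalerA.
exists n, (mk_linear f_lin) => y; have [c ->] := gP y.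
by exists (\row_i c i); apply: eq_bigr => i _; rewrite mxE.
Qed.

(** * Injective resolutions and derived functors *)

Section Resolution.
Variables (R : comNzRingType) (N : lmodType R) (E : inj_resolution N).

(* The resolution extended by zero in degree -1. *)
Definition prev_obj i : lmodType R := if i is j.+1 then E j else 'rV[R]_0.

Definition prev_d i : {linear prev_obj i -> E i} :=
  match i with
  | 0%N => (\0 : {linear 'rV[R]_0 -> E 0%N})
  | j.+1 => ir_d E j
  end.

Lemma prev_obj_injective i : injective_module (prev_obj i).
Proof.
case: i => [|i]; last exact: ir_injective.
by move=> A B f g _; exists \0 => x; rewrite [RHS]thinmx0 [LHS]thinmx0.
Qed.

(** Induction on [t] over all finitely generated M: the kernel of a surjection R^n -> M is again
    finitely generated, R being Noetherian, and is used one degree lower. *)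
Lemma exact_at_fin_gen (I : ideal R) (p : R -> bool) t (M : lmodType R) :
  prime_ideal p -> noetherian R -> fin_gen M ->
  (forall i, (i <= t)%N -> exact_at I p R^o (prev_d i) (ir_d E i)) ->
  exact_at I p M (prev_d t) (ir_d E t).
Proof.
move=> p_prime noethR; elim: t M => [|t IH] M /fin_gen_surj[n [f f_surj]] exR.
(* In degree 0 a second zero module is put before [prev_obj 0], so that exactness on the kernel is
   trivial. *)
- apply: (exact_at_quotient p_prime (a := \0 : {linear 'rV[R]_0 -> 'rV[R]_0})
    (b := prev_d 0) (c := ir_d E 0)
    noethR (@noetherian_rV R n noethR)
    (@prev_obj_injective 0) _ f_surj) => //; last first.
    exact: (exact_at_rV p_prime (exR 0%N isT)).
  move=> m h _ _; exists 1, m, (fun=> 0); split=> [||x _].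
  + exact: notin_prime1.
  + by move=> a x y _ _; rewrite scaler0 addr0.
  + by rewrite [LHS]thinmx0 [RHS]thinmx0.
- apply: (exact_at_quotient p_prime (a := prev_d t)
    noethR (@noetherian_rV R n noethR)
    (@prev_obj_injective t) _ f_surj) => [x||].
  + case: t x {IH exR} => [|t] x; first exact: linear0.
    by apply/ir_exact; exists x.
  + apply: IH; first by apply: fin_gen_kernel; exact: noetherian_rV.
    by move=> i it; apply: exR; exact: leqW.
  + exact: (exact_at_rV p_prime (exR t.+1 (leqnn _))).
Qed.

(** The cohomology vanishes at [p] when every cocycle is a coboundary up to a factor outside [p];
    this is [exact_at] read in the direct limit. *)
Lemma notin_Supp_derivedP (I : ideal R) (M : lmodType R) (p : R -> bool) t :
  prime_ideal p ->
  ~ Supp (derived_along (gen_ideal_transform I M) E t) p <->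
  exact_at I p M (prev_d t) (ir_d E t).
Proof.
move=> p_prime; rewrite notin_SuppP // cohomology_torsionP exact_atP.
have coP z :
    z \in coboundaries (fun n => mf_map (gen_ideal_transform I M) (ir_d E n)) t <->
    exists v, z = mf_map (gen_ideal_transform I M) (prev_d t) v.
  case: t z => [|t] z; first last.
    by split=> [/asboolP|ex] //; apply/asboolP.
  (* In degree 0 the coboundaries are zero by definition, so the map coming from the zero module in
     degree -1 must be shown to vanish. *)
  have null v : mf_map (gen_ideal_transform I M) (prev_d 0) v = 0.
    have [n [f [_ vf]]] := represents_exists v.
    by apply/(represents_eq (represents_map _ vf) (represents0 _ _ _)); exists n.
  split=> [/eqP->|[v ->]]; first by exists 0; rewrite null.
  by rewrite null rpred0.
split=> H u /H[s].
  by move=> [sp /coP[v]]; exists s, v.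
by move=> [v [sp e]]; exists s; split=> //; apply/coP; exists v.
Qed.

End Resolution.

Theorem corollary3p7 (R : comNzRingType) (I : ideal R) (M N : lmodType R)
    (t : nat) :
  noetherian R -> fin_gen M ->
  (forall i : nat, (i <= t)%N ->
     finite_set (Supp (right_derived (ideal_transform I) i N))) ->
  finite_set (Supp (right_derived (gen_ideal_transform I M) t N)).
Proof.
move=> noethR fgM finS.
pose S i := Supp (right_derived (ideal_transform I) i N).
(* The support lies in the union of the [S i] with [i <= t]: a prime outside all of them is outside
   the support as well. *)
apply: (@sub_finite_set _ _ (\bigcup_(i in `I_t.+1) S i)%classic).
  move=> p Mp; have [p_prime _] := Mp; apply: contrapT => nS.
  move: Mp; apply/notin_Supp_derivedP => //.
  (* [ideal_transform I] is the transform for [R^o], so lying outside [S i] is the exactness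
     required on [R^o]. *)
  apply: exact_at_fin_gen => // i it; apply/notin_Supp_derivedP => // Sp.
  by apply: nS; exists i.
by apply: bigcup_finite => [|i it]; [exact: finite_II|exact: finS].
Qed.
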